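(* Let $F$ be a field and let $A$ and $B$ be semi-simple $F$-algebras. Assume that $A$ or $B$ is separable over $F$. Then the orbit set $\mathcal{O}_{A,B}=B^\times\backslash\mathrm{Hom}_{F\text{-alg}}(A,B)$ is finite and $|\mathcal{O}_{A,B}|=|P(A,B)|$, where $P(A,B)$ is the set defined in the context.
   Context: All $F$-algebras are finite-dimensional over the (arbitrary) field $F$; $F$-algebra homomorphisms send the identity to the identity. An $F$-algebra is separable over $F$ if it is semi-simple and its center is a finite product of finite separable field extensions of $F$. $\mathrm{Hom}_{F\text{-alg}}(A,B)$ is the set of $F$-algebra homomorphisms $A\to B$; $B^\times$ acts on it on the left by $(b\cdot\varphi)(a)=b\,\varphi(a)\,b^{-1}$. For an $F$-algebra $C$, $C^{ss}:=C/\mathrm{rad}(C)$ with $\mathrm{rad}(C)$ the Jacobson radical; $A^{\mathrm{o}}$ is the opposite algebra. Definition of $P(A,B)$. If $B$ is simple, write $B=\mathrm{End}_\Delta(V)$ with $\Delta$ a division algebra over $F$ and $V$ a right $\Delta$-module. Write the Wedderburn decomposition $(\Delta\otimes_F A^{\mathrm{o}})^{ss}\simeq\prod_{i=1}^t\mathrm{Mat}_{m_i}(D_i)$ with $D_i$ division $F$-algebras, put $\ell_i:=m_i[D_i:F]/[\Delta:F]$ (a positive integer, since $\Delta$ embeds in $\mathrm{Mat}_{m_i}(D_i)$), and $$P(A,B):=\Big\{(x_1,\dots,x_t)\in\mathbb Z_{\ge 0}^t\ :\ \dim_\Delta V=\sum_{i=1}^t\ell_ix_i\Big\}.$$ If $B$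 is semi-simple, write $B=\prod_{j=1}^rB_j$ into simple factors and put $P(A,B):=\prod_{j=1}^rP(A,B_j)$. *)

(* Defs.v *)
From HB Require Import structures.
From mathcomp Require Import all_boot all_order all_algebra all_field.
From mathcomp Require Import boolp classical_sets functions cardinality.

Set Implicit Arguments.
Unset Strict Implicit.
Unset Printing Implicit Defensive.

Import GRing.Theory.
Local Open Scope ring_scope.

(* Finite-dimensional F-algebras are elements of [falgType F].  An isomorphism
   from an algebra X onto a product \prod_i Y_i is given by its components
   X -> Y_i: [forall y, exists! x, forall i, p i x = y i] says that the induced
   map X -> \prod_i Y_i is bijective. *)

Section Algebras.
Variables (F : fieldType) (A : falgType F).

Definition left_ideal (U : {vspace A}) : bool := ({:A} * U <= U)%VS.

Definition right_ideal (U : {vspace A}) : bool := (U * {:A} <= U)%VS.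

Definition maximal_left_ideal (M : {vspace A}) : Prop :=
  [/\ left_ideal M, M <> fullv &
      forall U : {vspace A}, left_ideal U -> (M <= U)%VS ->
        U = M \/ U = fullv].

Definition jacobson_radical (x : A) : Prop :=
  forall M : {vspace A}, maximal_left_ideal M -> x \in M.

(* The left regular module is semi-simple: each submodule has a complement. *)
Definition semisimple_algebra : Prop :=
  forall U : {vspace A}, left_ideal U ->
    exists W : {vspace A},
      [/\ left_ideal W, (U :&: W)%VS = 0%VS & (U + W)%VS = fullv].

Definition simple_algebra : Prop :=
  forall U : {vspace A}, left_ideal U -> right_ideal U ->
    U = 0%VS \/ U = fullv.

Definition division_algebra : Prop :=
  forall x : A, x != 0 -> x \is a GRing.unit.

Definition separable_algebra : Prop :=
  semisimple_algebra /\
  exists (n : nat) (L : 'I_n -> fieldExtType F)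
         (p : forall i, 'AHom(subvs_of 'Z({:A})%AS, L i)),
    (forall i, separable 1%VS {:L i}%VS) /\
    (forall y : forall i, L i, exists! z, forall i, p i z = y i).

End Algebras.

Section Orbits.
Variables (F : fieldType) (A B : falgType F).
Local Open Scope classical_set_scope.

Definition conj_orbit (phi : 'AHom(A, B)) : set 'AHom(A, B) :=
  [set psi | exists2 b : B, b \is a GRing.unit &
               forall a : A, psi a = b * phi a * b^-1].

(* B^x \ Hom(A, B), as the set of orbits. *)
Definition orbit_set : set (set 'AHom(A, B)) :=
  [set conj_orbit phi | phi in [set: 'AHom(A, B)]].

End Orbits.

(* T, with (x, a) |-> x (x) a, is the algebra Delta (x)_F A^o: the universal
   property of the tensor product of F-modules, and the multiplication
   (x (x) a)(y (x) b) = xy (x) ba. *)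
Record is_tensor_opp (F : fieldType) (Delta A T : falgType F)
    (tens : {bilinear Delta -> A -> T}) : Prop := {
  tensor_lift : forall (U : lmodType F) (f : {bilinear Delta -> A -> U}),
    exists g : {linear T -> U}, forall x a, g (tens x a) = f x a;
  tensor_ext : forall (U : lmodType F) (g h : {linear T -> U}),
    (forall x a, g (tens x a) = h (tens x a)) -> g =1 h;
  tensor_one : tens 1 1 = 1;
  tensor_mul : forall x y a b, tens x a * tens y b = tens (x * y) (b * a)
}.

(* B = End_Delta(V).  A right Delta-module is a left module over the converse
   ring Delta^c, so that [(d : Delta^c) *: v] is v d. *)
Record is_End (F : fieldType) (B Delta : falgType F) (V : vectType Delta^c)
    (rho : B -> 'End(V)) : Prop := {
  End_add : forall b c, rho (b + c) = rho b + rho c;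
  End_scale : forall (k : F) b v, rho (k *: b) v = (k%:A : Delta^c) *: rho b v;
  End_one : rho 1 = \1%VF;
  End_mul : forall b c, rho (b * c) = (rho b \o rho c)%VF;
  End_bij : bijective rho
}.

(* T^ss = T / rad(T) is isomorphic to \prod_i Mat_(m i)(D i): a family of
   F-algebra homomorphisms such that T -> \prod_i Mat_(m i)(D i) is onto with
   kernel rad(T).  The scaling operator is multiplication by k%:A : D i, the
   F-algebra structure of Mat_(m i)(D i). *)
Record is_wedderburn (F : fieldType) (T : falgType F) (t : nat)
    (D : 'I_t -> falgType F) (m : 'I_t -> nat)
    (p : forall i, {lrmorphism T -> 'M[D i]_(m i) | in_alg (D i) \; *:%R}) :
    Prop := {
  wedderburn_division : forall i, division_algebra (D i);
  wedderburn_size : forall i, (0 < m i)%N;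
  wedderburn_onto : forall y : forall i, 'M[D i]_(m i),
    exists x, forall i, p i x = y i;
  wedderburn_ker : forall x, (forall i, p i x = 0) <-> jacobson_radical x
}.

(* The choices made to write down P(A, B), for B simple. *)
Record simple_data (F : fieldType) (A B : falgType F) := {
  sd_Delta : falgType F;
  sd_Delta_division : division_algebra sd_Delta;
  sd_V : vectType sd_Delta^c;
  sd_rho : B -> 'End(sd_V);
  sd_rhoP : is_End sd_rho;
  sd_T : falgType F;
  sd_tens : {bilinear sd_Delta -> A -> sd_T};
  sd_tensP : is_tensor_opp sd_tens;
  sd_t : nat;
  sd_D : 'I_sd_t -> falgType F;
  sd_m : 'I_sd_t -> nat;
  sd_p : forall i,
    {lrmorphism sd_T -> 'M[sd_D i]_(sd_m i) | in_alg (sd_D i) \; *:%R};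
  sd_pP : is_wedderburn sd_p
}.

(* The division is exact: Delta embeds in Mat_(m i)(D i). *)
Definition ell (F : fieldType) (A B : falgType F) (d : simple_data A B)
    (i : 'I_(sd_t d)) : nat :=
  ((sd_m i * \dim {:sd_D i}) %/ \dim {:sd_Delta d})%N.

Definition P_simple (F : fieldType) (A B : falgType F) (d : simple_data A B) :
    set ('I_(sd_t d) -> nat) :=
  [set x | dim (sd_V d) = (\sum_i ell i * x i)%N]%classic.

(* The choices made to write down P(A, B), for B semi-simple. *)
Record semisimple_data (F : fieldType) (A B : falgType F) := {
  ssd_r : nat;
  ssd_factor : 'I_ssd_r -> falgType F;
  ssd_simple : forall j, simple_algebra (ssd_factor j);
  ssd_proj : forall j, 'AHom(B, ssd_factor j);
  ssd_proj_bij : forall y : forall j, ssd_factor j,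
    exists! b, forall j, ssd_proj j b = y j;
  ssd_data : forall j, simple_data A (ssd_factor j)
}.

Definition P_set (F : fieldType) (A B : falgType F) (d : semisimple_data A B) :
    set (forall j : 'I_(ssd_r d), 'I_(sd_t (ssd_data j)) -> nat) :=
  [set x | forall j, P_simple (x j)]%classic.

Arguments orbit_set [F] A B.
Arguments P_set [F A B] d.

(* Main.v *)
(* A separable algebra has a separability idempotent, so averaging a linear
   projection shows that bimodules over a semisimple and a separable algebra
   are semisimple.

   Finiteness: each f : A -> B exhibits B as a quotient of the free bimodule
   B (x) A, hence as isomorphic to a subsum of a fixed finite family of simple
   bimodules, and the subsum determines the orbit of f.

   Counting, for B = End_D(V): f makes V a right module over the semisimple
   algebra T = D (x) A^o = \prod_i Mat_(m i)(D i), two homomorphisms are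
   conjugate iff these modules are isomorphic, and the modules extending the
   right D-structure of V are the \bigoplus_i S_i^(x i), S_i simple, with
   \sum_i x i * dim_D S_i = dim_D V, where dim_D S_i = ell i. *)
From HB Require Import structures.
Require Import Defs.
From mathcomp Require Import all_boot all_order all_algebra all_field.
From mathcomp Require Import boolp classical_sets functions cardinality.

Set Implicit Arguments.
Unset Strict Implicit.
Unset Printing Implicit Defensive.

Import GRing.Theory.
Local Open Scope ring_scope.

(** * Linear algebra *)

(** Separability is defined through the centre, so the idempotent of A has to be built from that of
    Z(A). Instead of extending the base field to split A, a least-support argument on tuples with
    entries in A ([central_coordinates]) is applied twice.

    The finiteness claim comes without any [semisimple_data]; it is therefore proved separately,
    without decomposing B, and the count is a bijection for each choice of data.

    The Wedderburn data describe T only modulo its radical. The count needs rad(T) = 0, and this is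
    the one place where separability enters it. If A is separable, averaging applies at once, since
    D is a division algebra; if B is, its idempotent must first be carried over to D. The two cases
    give complements of left, respectively right, ideals of T, and von Neumann regularity is the
    common consequence that kills the radical. *)

Lemma linear_pack (R : nzRingType) (V W : lmodType R) (f : V -> W) :
  linear f -> {g : {linear V -> W} | f = g}.
Proof.
move=> lf; pose g : {linear V -> W} := HB.pack f (GRing.isLinear.Build R V W _ f lf).
by exists g.
Qed.

Lemma linfunE (R : nzRingType) (aT rT : vectType R) (f : aT -> rT) :
  linear f -> linfun f =1 f.
Proof. by case/linear_pack=> g ->; apply: lfunE. Qed.

Section LinearAlgebra.
Variable F : fieldType.

Lemma lin_sum (V W : lmodType F) (f : V -> W) (I : Type) (r : seq I)
    (P : pred I) (E : I -> V) :
  linear f -> f (\sum_(i <- r | P i) E i) = \sum_(i <- r | P i) f (E i).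
Proof. by case/linear_pack=> g ->; apply: linear_sum. Qed.

Lemma lin0 (V W : lmodType F) (f : V -> W) : linear f -> f 0 = 0.
Proof. by case/linear_pack=> g ->; apply: linear0. Qed.

Lemma linZ (V W : lmodType F) (f : V -> W) k x :
  linear f -> f (k *: x) = k *: f x.
Proof. by case/linear_pack=> g ->; apply: linearZ. Qed.

Lemma bilinfunE (aT bT cT : vectType F) (f : aT -> bT -> cT) :
    (forall a, linear (f a)) -> (forall b, linear (f^~ b)) ->
  forall a b, linfun (fun a => linfun (f a)) a b = f a b.
Proof.
move=> lr ll a b; rewrite linfunE ?linfunE // => k x y.
apply/lfunP=> z; rewrite add_lfunE scale_lfunE !linfunE //; exact: ll.
Qed.

(** A subspace of largest dimension inside [P] contains every vector of [P]: otherwise adding the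
    line of that vector would enlarge it. *)
Lemma vspace_of_pred (V : vectType F) (P : V -> Prop) :
    P 0 -> (forall k u v, P u -> P v -> P (k *: u + v)) ->
  {U : {vspace V} | forall v, v \in U <-> P v}.
Proof.
move=> P0 PD; apply: cid.
pose Q n := `[< exists2 U : {vspace V}, \dim U = n & forall v, v \in U -> P v >].
have exQ : exists n, Q n.
  exists 0%N; apply/asboolP; exists 0%VS; first exact: dimv0.
  by move=> v; rewrite memv0 => /eqP->.
have bQ n : Q n -> (n <= \dim {:V})%N.
  by move=> /asboolP[U <- _]; rewrite dimvS ?subvf.
case: (ex_maxnP exQ bQ) => m /asboolP[U dU UP] mmax.
exists U => v; split=> [/UP//|Pv].
have /mmax : Q (\dim (U + <[v]>)%VS).
  apply/asboolP; exists (U + <[v]>)%VS => // w /memv_addP[u /UP Pu [_ /vlineP[k ->] ->]].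
  by rewrite addrC; apply: PD.
rewrite -dU => le; have [_ h] := dimv_leqif_sup (addvSl U <[v]>).
have : \dim U == \dim (U + <[v]>)%VS by rewrite eqn_leq le dimvS ?addvSl.
by rewrite h subv_add => /andP[_]; rewrite -memvE.
Qed.

Lemma memv_0cap (V : vectType F) (U W : {vspace V}) v :
  (U :&: W = 0)%VS -> v \in U -> v \in W -> v = 0.
Proof. by move=> UW0 vU vW; apply/eqP; rewrite -memv0 -UW0 memv_cap vU. Qed.

Lemma cap0vP (V : vectType F) (U W : {vspace V}) :
  (forall v, v \in U -> v \in W -> v = 0) -> (U :&: W = 0)%VS.
Proof.
move=> h; apply/eqP; rewrite -subv0; apply/subvP => v.
by rewrite memv_cap memv0 => /andP[vU /(h _ vU) ->].
Qed.

Lemma fullvP (V : vectType F) (U : {vspace V}) :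
  (forall v, v \in U) -> U = fullv.
Proof. by move=> h; apply/vspaceP => v; rewrite h memvf. Qed.

(** Since [f] is injective on [N], the partial inverse of [f] composed with the projection to [N]
    recovers [w] from [f w]; only the values on [f @: N] matter. *)
Lemma lfun_factor (W M M' : vectType F) (f : 'Hom(W, M)) (g : 'Hom(W, M'))
    (N : {vspace W}) :
  (N :&: lker f = 0)%VS -> exists h : 'Hom(M, M'), {in N, forall w, h (f w) = g w}.
Proof.
move=> f0; pose q := (f \o projv N)%VF.
exists (g \o projv N \o q^-1)%VF => w wN.
have qf : f w \in limg q.
  by rewrite -(projv_id wN) -comp_lfunE memv_img ?memvf.
have := limg_lfunVK qf; rewrite !comp_lfunE; set z := projv N _ => fz.
suff -> : w = z by [].
apply/eqP; rewrite -subr_eq0; apply/eqP; apply: (memv_0cap f0).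
  by rewrite memvB // memv_proj.
by rewrite memv_ker linearB /= fz subrr.
Qed.

(** [N] is a common complement of the two kernels, so both targets are copies of [N]. Stability of
    [N] under operators later makes [h] equivariant. *)
Lemma transport_iso (W M M' : vectType F) (f : 'Hom(W, M)) (g : 'Hom(W, M'))
    (N : {vspace W}) :
    (N :&: lker f = 0)%VS -> (f @: N = fullv)%VS ->
    (N :&: lker g = 0)%VS -> (g @: N = fullv)%VS ->
  exists (h : 'Hom(M, M')) (h' : 'Hom(M', M)),
    [/\ cancel h h', cancel h' h & {in N, forall w, h (f w) = g w}].
Proof.
move=> f0 fN g0 gN; have [h hP] := lfun_factor g f0.
have [h' h'P] := lfun_factor f g0; exists h, h'; split=> //.
  move=> m; have : m \in (f @: N)%VS by rewrite fN memvf.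
  by case/memv_imgP=> w wN ->; rewrite hP // h'P.
move=> m; have : m \in (g @: N)%VS by rewrite gN memvf.
by case/memv_imgP=> w wN ->; rewrite h'P // hP.
Qed.

Lemma dimv_bij (V W : vectType F) (f : 'Hom(V, W)) U U' :
  (U :&: lker f = 0)%VS -> (f @: U = U')%VS -> \dim U = \dim U'.
Proof. by move=> h <-; rewrite limg_dim_eq. Qed.

Lemma dimv_ffun (S : finType) (V : vectType F) (E : S -> {vspace V})
    (N : {vspace {ffun S -> V}}) :
    (forall f : {ffun S -> V}, f \in N <-> forall s, f s \in E s) ->
  \dim N = (\sum_s \dim (E s))%N.
Proof.
move=> NP.
pose io (s : S) (v : V) : {ffun S -> V} := [ffun s' => if s' == s then v else 0].
have iol s : linear (io s).
  move=> k u v; apply/ffunP=> s'; rewrite !ffunE; case: eqP => // _.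
  by rewrite scaler0 addr0.
pose I s : 'Hom(V, {ffun S -> V}) := linfun (io s).
have IE s v : I s v = io s v by rewrite linfunE.
have dI s : \dim (I s @: E s)%VS = \dim (E s).
  apply: limg_dim_eq; apply: cap0vP => v _; rewrite memv_ker IE => /eqP /ffunP /(_ s).
  by rewrite !ffunE eqxx.
have -> : N = (\sum_s (I s @: E s))%VS.
  apply/vspaceP => f; apply/idP/memv_sumP.
    move/NP=> fE; exists (fun s => I s (f s)); first by move=> s _; apply: memv_img.
    apply/ffunP=> s'; rewrite sum_ffunE (bigD1 s') //= big1 ?addr0.
      by rewrite IE ffunE eqxx.
    by move=> s ne; rewrite IE ffunE eq_sym (negbTE ne).
  case=> vs vsE ->; apply/NP => s; rewrite sum_ffunE; apply: memv_suml => s' _.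
  have /memv_imgP[v vE ->] := vsE s' isT.
  by rewrite IE ffunE; case: eqP => [->|_] //; apply: mem0v.
have : directv (\sum_s (I s @: E s)).
  apply/directv_sum_independent => us usE sum0 s _.
  have hu s' : us s' = io s' (us s' s').
    have /memv_imgP[v _ ->] := usE s' isT; rewrite IE; congr io.
    by rewrite ffunE eqxx.
  move/ffunP: sum0 => /(_ s); rewrite sum_ffunE ffunE (bigD1 s) //= big1 => [|s' ne].
    rewrite addr0 => us0; rewrite hu us0; apply/ffunP=> s'; rewrite !ffunE.
    by case: ifP.
  by rewrite hu ffunE eq_sym (negbTE ne).
by rewrite directvE /= => /eqP ->; apply: eq_bigr => s _.
Qed.

End LinearAlgebra.

Lemma falg_dim_gt0 (F : fieldType) (D : falgType F) : (0 < \dim {:D})%N.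
Proof.
rewrite lt0n dimv_eq0; apply/eqP => D0; have := memvf (1 : D).
by rewrite D0 memv0 oner_eq0.
Qed.

(** * Semisimple algebras *)

Section SemisimpleAlgebra.
Variables (F : fieldType) (A : falgType F).

Lemma left_idealP (U : {vspace A}) :
  left_ideal U <-> forall a u, u \in U -> a * u \in U.
Proof.
split=> [/prodvP h a u uU|h]; first by apply: h; rewrite ?memvf.
by apply/prodvP => a u _; apply: h.
Qed.

Lemma right_idealP (U : {vspace A}) :
  right_ideal U <-> forall a u, u \in U -> u * a \in U.
Proof.
split=> [/prodvP h a u uU|h]; first by apply: h; rewrite ?memvf.
by apply/prodvP => a u uU _; apply: h.
Qed.

Lemma left_ideal_line (x : A) : left_ideal ({:A} * <[x]>)%VS.
Proof.
apply/left_idealP => a _ /memv_cosetP[b _ ->].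
by rewrite mulrA; apply/memv_cosetP; exists (a * b); rewrite ?memvf.
Qed.

Lemma mem_left_line (x : A) : x \in ({:A} * <[x]>)%VS.
Proof. by apply/memv_cosetP; exists 1; rewrite ?memvf ?mul1r. Qed.

Hypothesis ssA : semisimple_algebra A.

(** Split 1 = e + f along a complement of [U]: then x - x e = x f lies in both summands. *)
Lemma left_ideal_idempotent (U : {vspace A}) : left_ideal U ->
  exists2 e, e \in U & {in U, forall x, x * e = x}.
Proof.
move=> Uid; have [W [Wid UW0 UWf]] := ssA Uid.
have := memvf (1 : A); rewrite -UWf => /memv_addP[e eU [f fW ef]].
exists e => // x xU; apply/eqP; rewrite eq_sym -subr_eq0; apply/eqP.
have /left_idealP Ul := Uid; have /left_idealP Wl := Wid.
apply: (memv_0cap UW0); first by rewrite memvB // Ul.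
by rewrite -[X in X - _]mulr1 -mulrBr ef [e + f]addrC addrK Wl.
Qed.

(** The right unit of [U] turns out to be a left unit too; then a e = e a e = e a for every a. *)
Lemma ideal_central_idempotent (U : {vspace A}) :
    left_ideal U -> right_ideal U ->
  exists2 e, e \in U & {in U, forall x, x * e = x} /\ forall a, a * e = e * a.
Proof.
move=> Ul Ur; have [e eU ue] := left_ideal_idempotent Ul.
have /left_idealP Ulm := Ul; have /right_idealP Urm := Ur.
have eu u : u \in U -> e * u = u.
  (* The defect [n] satisfies e n = 0. An idempotent g = a n generating A n equals a (n a) n, and n
     a = (n a) e because n a is in [U]; hence g = 0 and n = n g = 0. *)
  move=> uU; pose n := u - e * u.
  have nU : n \in U by rewrite memvB // Ulm.
  have en0 : e * n = 0 by rewrite mulrBr mulrA ue // subrr.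
  have [g /memv_cosetP[a _ ga] gn] := left_ideal_idempotent (left_ideal_line n).
  have gg : g * g = g by apply: gn; rewrite ga; apply/memv_cosetP; exists a; rewrite ?memvf.
  have g0 : g = 0.
    rewrite -gg {1}ga ga -!mulrA [n * (a * n)]mulrA -(ue (n * a)) ?Urm //.
    by rewrite -mulrA en0 !mulr0.
  by have := gn n (mem_left_line n); rewrite g0 mulr0 => /esym/eqP; rewrite subr_eq0 eq_sym => /eqP.
exists e => //; split=> // a.
by rewrite -(eu (a * e)) ?Ulm // mulrA ue ?Urm.
Qed.

Section CentralCoordinates.
Variables (n : nat) (P : {ffun 'I_n -> A} -> Prop).
Hypotheses (P0 : P 0) (PD : forall k f g, P f -> P g -> P (k *: f + g)).
Hypothesis Pl : forall a f, P f -> P [ffun i => a * f i].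
Hypothesis Pr : forall a f, P f -> P [ffun i => f i * a].

(* Among the nonzero elements of least support, normalise one coordinate to a
   central idempotent: the commutators with A have smaller support, so vanish. *)
Lemma central_coordinates f : P f -> f != 0 ->
  exists g, [/\ P g, g != 0 & forall i a, a * g i = g i * a].
Proof.
move=> Pf f0.
pose supp (g : {ffun 'I_n -> A}) := [set i | g i != 0]%SET.
pose Q m := `[< exists g, [/\ P g, g != 0 & #|supp g| = m] >].
have exQ : exists m, Q m by exists #|supp f|; apply/asboolP; exists f.
case: (ex_minnP exQ) => m /asboolP[g [Pg g0 gm]] mmin.
have small h : P h -> (supp h \proper supp g)%SET -> h = 0.
  move=> Ph hg; apply: contrapT => /eqP h0.
  have /mmin : Q #|supp h| by apply/asboolP; exists h.
  by rewrite -gm leqNgt proper_card.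
have [j gj] : exists j, g j != 0.
  apply/existsP; apply: contraNT g0; rewrite negb_exists => /forallP h.
  by apply/eqP/ffunP=> j; rewrite ffunE; apply/eqP; rewrite -[_ == _]negbK.
have suppP (h : {ffun 'I_n -> A}) : (supp h \subset supp g)%SET <-> forall i, g i = 0 -> h i = 0.
  split=> [/fintype.subsetP hs i gi|hs].
    apply/eqP; apply: contraTT isT => hi.
    by have := hs i; rewrite !inE hi gi eqxx => /(_ isT).
  by apply/fintype.subsetP=> i; rewrite !inE; apply: contraNneq => /hs ->.
(* The j-th entries of the members of [P] supported inside the support of [g] form a two-sided
   ideal, as [P] is stable on both sides. It contains g j, so its central idempotent is nonzero. *)
pose I x := exists h, [/\ P h, (supp h \subset supp g)%SET & h j = x].
have [|k u v|U UP] := @vspace_of_pred F A I.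
- exists 0; split=> //; last by rewrite ffunE.
  by apply/suppP => i _; rewrite ffunE.
- move=> [h [Ph /suppP sh <-]] [h' [Ph' /suppP sh' <-]]; exists (k *: h + h').
  split; [exact: PD| |by rewrite !ffunE].
  by apply/suppP => i gi; rewrite !ffunE sh // sh' // scaler0 addr0.
have Ul : left_ideal U.
  apply/left_idealP => a _ /UP[h [Ph /suppP sh <-]]; apply/UP.
  exists [ffun i => a * h i]; split; [exact: Pl| |by rewrite ffunE].
  by apply/suppP => i gi; rewrite ffunE sh ?mulr0.
have Ur : right_ideal U.
  apply/right_idealP => a _ /UP[h [Ph /suppP sh <-]]; apply/UP.
  exists [ffun i => h i * a]; split; [exact: Pr| |by rewrite ffunE].
  by apply/suppP => i gi; rewrite ffunE sh ?mul0r.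
have [e /UP[h [Ph /suppP sh hj]] [Ue ec]] := ideal_central_idempotent Ul Ur.
have gjU : g j \in U by apply/UP; exists g; split.
have e0 : e != 0 by apply: contraNneq gj => e0; rewrite -(Ue _ gjU) e0 mulr0.
exists h; split=> //.
  by apply: contraNneq e0 => h0; rewrite -hj h0 ffunE.
move=> i a.
pose k : {ffun 'I_n -> A} := (-1) *: [ffun i => h i * a] + [ffun i => a * h i].
suff /ffunP/(_ i) : k = 0.
  by rewrite !ffunE scaleN1r addrC => /eqP; rewrite subr_eq0 => /eqP.
apply: small; first by apply: PD; [apply: Pr | apply: Pl].
rewrite properE; apply/andP; split.
  by apply/suppP => i' gi; rewrite !ffunE sh // mul0r mulr0 scaler0 addr0.
apply/fintype.subsetPn; exists j; rewrite !inE //.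
by rewrite !ffunE hj ec scaleN1r addNr eqxx.
Qed.

End CentralCoordinates.

End SemisimpleAlgebra.

(** * Separability idempotents *)

Section Tensor.
Variables (F : fieldType) (X Y : falgType F).

(* [{ffun 'I_(\dim X) -> Y}] is X (x)_F Y, written on the basis of X. *)
Notation XY := {ffun 'I_(\dim {:X}) -> Y}.

Definition tens (x : X) (y : Y) : XY :=
  [ffun i => coord (vbasis {:X}) i x *: y].

Definition tens_lift (U : lmodType F) (b : X -> Y -> U) (w : XY) : U :=
  \sum_(i < \dim {:X}) b (vbasis {:X})`_i (w i).

Lemma tens_linearl y : linear (tens^~ y).
Proof.
by move=> k x x'; apply/ffunP=> i; rewrite !ffunE linearP scalerDl scalerA.
Qed.

Lemma tens_linearr x : linear (tens x).
Proof.
by move=> k y y'; apply/ffunP=> i; rewrite !ffunE scalerDr !scalerA mulrC.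
Qed.

Lemma tensZl k x y : tens (k *: x) y = k *: tens x y.
Proof. exact: (linZ _ _ (tens_linearl y)). Qed.

Lemma tensZr k x y : tens x (k *: y) = k *: tens x y.
Proof. exact: (linZ _ _ (tens_linearr x)). Qed.

Lemma tens0l y : tens 0 y = 0.
Proof. exact: (lin0 (tens_linearl y)). Qed.

Lemma tens0r x : tens x 0 = 0.
Proof. exact: (lin0 (tens_linearr x)). Qed.

Lemma tens_lift_linear (U : lmodType F) (b : X -> Y -> U) :
  (forall x, linear (b x)) -> linear (tens_lift b).
Proof.
move=> bl k w w'; rewrite /tens_lift scaler_sumr -big_split.
by apply: eq_bigr => i _; rewrite !ffunE bl.
Qed.

Lemma tens_liftE (U : lmodType F) (b : X -> Y -> U) x y :
    (forall x, linear (b x)) -> (forall y, linear (b^~ y)) ->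
  tens_lift b (tens x y) = b x y.
Proof.
move=> br bl; rewrite {2}(coord_vbasis (memvf x)) /tens_lift.
rewrite (lin_sum _ _ _ (bl y)); apply: eq_bigr => i _; rewrite ffunE.
by rewrite (linZ _ _ (br _)) (linZ _ _ (bl y)).
Qed.

Definition lmulf (a : Y) (w : XY) : XY := [ffun i => a * w i].

Definition rmulf (a : Y) (w : XY) : XY := [ffun i => w i * a].

Lemma lmulf_linear a : linear (lmulf a).
Proof.
by move=> k f g; apply/ffunP=> i; rewrite !ffunE mulrDr -scalerAr.
Qed.

Lemma rmulf_linear a : linear (rmulf a).
Proof.
by move=> k f g; apply/ffunP=> i; rewrite !ffunE mulrDl -scalerAl.
Qed.

Lemma lmulf_tens a x y : lmulf a (tens x y) = tens x (a * y).
Proof. by apply/ffunP=> i; rewrite !ffunE -scalerAr. Qed.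

Lemma rmulf_tens a x y : rmulf a (tens x y) = tens x (y * a).
Proof. by apply/ffunP=> i; rewrite !ffunE -scalerAl. Qed.

Lemma tens_gen (w : XY) : w = \sum_(i < \dim {:X}) tens (vbasis {:X})`_i (w i).
Proof.
apply/ffunP=> j; rewrite sum_ffunE (bigD1 j) //= big1 ?addr0 => [|i ne].
  by rewrite ffunE coord_free ?eqxx ?scale1r // (basis_free (vbasisP _)).
rewrite ffunE coord_free ?(basis_free (vbasisP _)) //.
by rewrite (negbTE ne) scale0r.
Qed.

End Tensor.

(** * Separability idempotents as lists of pairs *)

Section SeparableFamily.
Variables (F : fieldType) (A : falgType F).

(** The equation a.s = s.a in A (x) A. The tensor is kept as a list of pairs, so that any bilinear
    map can be summed over it. *)
Definition balanced (s : seq (A * A)) (a : A) :=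
  \sum_(p <- s) tens (a * p.1) p.2 = \sum_(p <- s) tens p.1 (p.2 * a).

(* [s] stands for the separability idempotent \sum_(p <- s) p.1 (x) p.2. *)
Definition sep_family (s : seq (A * A)) :=
  \sum_(p <- s) p.1 * p.2 = 1 /\ forall a, balanced s a.

(** Equal tensors have equal images under the linear map induced by [b]; the idempotent is used
    through this lemma throughout. *)
Lemma balanced_lift s a (U : lmodType F) (b : A -> A -> U) : balanced s a ->
    (forall x, linear (b x)) -> (forall y, linear (b^~ y)) ->
  \sum_(p <- s) b (a * p.1) p.2 = \sum_(p <- s) b p.1 (p.2 * a).
Proof.
move=> sa br bl; have := congr1 (tens_lift b) sa.
rewrite !(lin_sum _ _ _ (tens_lift_linear br)) => e.
transitivity (\sum_(p <- s) tens_lift b (tens (a * p.1) p.2)).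
  by apply: eq_bigr => p _; rewrite tens_liftE.
by rewrite e; apply: eq_bigr => p _; rewrite tens_liftE.
Qed.

(** With [balanced0], [balanced1] and [balancedM], the elements that commute with [s] form a
    subalgebra, so it is enough to test a generator. *)
Lemma balanced_linear s k a b : balanced s a -> balanced s b ->
  balanced s (k *: a + b).
Proof.
rewrite /balanced => ha hb.
under eq_bigr do rewrite mulrDl -scalerAl tens_linearl.
under [RHS]eq_bigr do rewrite mulrDr -scalerAr tens_linearr.
by rewrite !big_split -!scaler_sumr ha hb.
Qed.

Lemma balanced0 s : balanced s 0.
Proof. by apply: eq_bigr => p _; rewrite mul0r mulr0 tens0l tens0r. Qed.

Lemma balanced1 s : balanced s 1.
Proof. by apply: eq_bigr => p _; rewrite mul1r mulr1. Qed.

Lemma balancedM s a b : balanced s a -> balanced s b -> balanced s (a * b).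
Proof.
move=> ha hb; rewrite /balanced.
under eq_bigr do rewrite -mulrA.
rewrite (balanced_lift (b := fun x y => tens (a * x) y) hb); first last.
- by move=> y k x x'; rewrite mulrDr -scalerAr tens_linearl.
- by move=> x; apply: tens_linearr.
rewrite (balanced_lift (b := fun x y => tens x (y * b)) ha); first last.
- by move=> y; apply: tens_linearl.
- by move=> x k y y'; rewrite mulrDl -scalerAl tens_linearr.
by apply: eq_bigr => p _; rewrite mulrA.
Qed.

End SeparableFamily.

(** This is (X - Y) \sum_(i < m) X^i Y^(m-1-i) = X^m - Y^m, with X = x (x) 1 and Y = 1 (x) x,
    multiplied by c (x) 1. *)
Lemma balanced_telescope (F : fieldType) (A : falgType F) (c x : A) m :
    c * x = x * c ->
  \sum_(i < m) (tens (x * (c * x ^+ i)) (x ^+ (m.-1 - i))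
    - tens (c * x ^+ i) (x ^+ (m.-1 - i) * x))
  = tens (c * x ^+ m) 1 - tens c (x ^+ m).
Proof.
move=> cx.
rewrite (eq_bigr (fun i : 'I_m => tens (c * x ^+ i.+1) (x ^+ (m - i.+1))
   - tens (c * x ^+ i) (x ^+ (m - i)))) => [|i _].
  rewrite -(big_mkord xpredT (fun i => tens (c * x ^+ i.+1) (x ^+ (m - i.+1))
     - tens (c * x ^+ i) (x ^+ (m - i)))).
  by rewrite telescope_sumr // subnn subn0 !expr0 mulr1.
case: m i => [[]//|m i] /=.
by rewrite mulrA -cx -mulrA -exprS -exprSr subSS -subSn // -ltnS.
Qed.

(* Euler: with f the minimal polynomial of a generator x, the separability
   idempotent is (f(X) - f(Y)) / (X - Y) at (x (x) 1, 1 (x) x), divided by f'(x). *)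
Lemma separable_field_family (F : fieldType) (L : fieldExtType F) :
  separable 1%VS {:L}%VS -> exists s : seq (L * L), sep_family s.
Proof.
move=> sepL; have gen := eq_adjoin_separable_generator sepL (sub1v _).
have sx := separable_generatorP {:L}%AS 1%AS.
set x := separable_generator _ _ in gen sx.
pose f := minPoly 1 x; pose d := f^`().[x].
have d0 : d != 0.
  by move: (separable_root_der 1%AS x); rewrite sx addTb => /negPf; rewrite /root => ->.
(* Monomial by monomial, (X^m - Y^m) / (X - Y) is \sum_(i < m) X^i Y^(m-1-i). Multiplying out the
   tensors gives \sum_m m f_m x^(m-1) / f'(x) = 1. *)
pose s := [seq (f`_m * d^-1 * x ^+ i, x ^+ (m.-1 - i)) | m <- iota 0 (size f), i <- iota 0 m].
have sE (U : zmodType) (b : L * L -> U) : \sum_(p <- s) b p =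
    \sum_(m < size f) \sum_(i < m) b (f`_m * d^-1 * x ^+ i, x ^+ (m.-1 - i)).
  rewrite big_allpairs_dep /= -[size f]subn0 -/(index_iota 0 _) big_mkord subn0.
  by apply: eq_bigr => m _; rewrite -{1}[val m]subn0 -/(index_iota 0 _) big_mkord.
exists s; split.
  rewrite sE /= (eq_bigr (fun m : 'I_(size f) => d^-1 * (f`_m *+ m * x ^+ m.-1))).
    rewrite -mulr_sumr -(divff d0) mulrC; congr (_ / _).
    rewrite /d /deriv horner_poly.
    case: (size f) => [|n]; first by rewrite !big_ord0.
    rewrite big_ord_recl /= mulr0n mul0r add0r.
    by apply: eq_bigr.
  move=> m _; rewrite (eq_bigr (fun=> d^-1 * (f`_m * x ^+ m.-1))).
    by rewrite sumr_const card_ord -mulrnAr mulrnAl.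
  move=> i _ /=; rewrite -(mulrA (_ / _)) -exprD subnKC; first by rewrite -mulrA mulrCA.
  by case: (val m) i => [[]//|n [i]].
have fx : \sum_(m < size f) f`_m * x ^+ m = 0.
  by rewrite -horner_coef minPolyxx.
have bx : balanced s x.
  apply/eqP; rewrite -subr_eq0 !sE /= -sumrB.
  under eq_bigr => m _ do rewrite -sumrB balanced_telescope ?[_ * x]mulrC //.
  rewrite sumrB.
  have -> : \sum_(m < size f) tens (f`_m / d * x ^+ m) 1 =
      tens (d^-1 * \sum_(m < size f) f`_m * x ^+ m) 1 :> {ffun _ -> L}.
    rewrite mulr_sumr (lin_sum _ _ _ (tens_linearl (1 : L))).
    by apply: eq_bigr => m _; rewrite mulrAC mulrC mulrA.
  (* The coefficients of the minimal polynomial are scalars, so they cross the tensor sign and f(x)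
     = 0 appears in the second factor. *)
  have -> : \sum_(m < size f) tens (f`_m / d) (x ^+ m) =
      tens d^-1 (\sum_(m < size f) f`_m * x ^+ m) :> {ffun _ -> L}.
    rewrite (lin_sum _ _ _ (tens_linearr d^-1)); apply: eq_bigr => m _.
    have /polyOverP/(_ m)/vlineP[k ->] := minPolyOver 1%AS x.
    rewrite -!scalerAl !mul1r.
    by rewrite tensZl tensZr.
  by rewrite fx mulr0 tens0l tens0r subrr.
move=> a; have : a \in <<1; x>>%VS by rewrite -gen memvf.
case/Fadjoin_polyP => p p1 ->; rewrite horner_coef.
apply: (big_ind (balanced s)) => [|u v hu hv|i _]; first exact: balanced0.
  by rewrite -[u]scale1r; apply: balanced_linear.
have /polyOverP/(_ i)/vlineP[k ->] := p1; rewrite -scalerAl mul1r.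
rewrite -[X in balanced _ X]addr0; apply: balanced_linear; last exact: balanced0.
elim: (val i) => [|n IH]; first exact: balanced1.
by rewrite exprS; apply: balancedM.
Qed.

(** * The centre of a separable algebra *)

Section SeparableAlgebra.
Variables (F : fieldType) (A : falgType F).

Definition central (z : A) := forall a, a * z = z * a.

(** The product decomposition of Z(A), read inside A: [e i] is the unit of the i-th field factor,
    the inverses [z'] say that Z(A) e i is a field, and [s] is the sum of the separability
    idempotents of the factors. Balance is claimed only against central elements. *)
Lemma separable_center : separable_algebra A ->
  exists (n : nat) (e : 'I_n -> A) (s : seq (A * A)),
    [/\ \sum_i e i = 1,
        forall i, central (e i),
        forall i, e i * e i = e i
      & forall i z, central z -> z * e i != 0 ->
          exists2 z', central z' & z * z' = e i] /\
    [/\ forall p, p \in s -> central p.1 /\ central p.2,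
        \sum_(p <- s) p.1 * p.2 = 1
      & forall z, central z -> balanced s z].
Proof.
case=> _ [n [L [p [sepL pbij]]]].
pose Z := subvs_of 'Z({:A})%AS.
have Zc (z : Z) : central (val z).
  by move=> a; have := subvsP z; rewrite memv_cap => /andP[_ /centvP->]; rewrite ?memvf.
have cZ z : central z -> z \in 'Z({:A})%VS.
  by move=> cz; rewrite memv_cap memvf; apply/centvP => a _; rewrite cz.
have Z1 : vsval (1 : Z) = 1.
  by rewrite /= algid_center; apply/eqP; rewrite algid_eq1 memvf.
have inj (z z' : Z) : (forall i, p i z = p i z') -> z = z'.
  move=> h; have [w [_ wu]] := pbij (fun i => p i z).
  by rewrite -(wu z) // -(wu z') // => i; rewrite h.
pose z0 i : L i := 0.
(* [q i l] is the central element with component l in the factor i and 0 in the others; [e i] will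
   be [q i 1]. *)
have [q qP] : exists q : forall i, L i -> Z, forall i (l : L i) j,
    p j (q i l) = dfwith z0 l j.
  have h i (l : L i) : {z : Z | forall j, p j z = dfwith z0 l j}.
    by apply: cid; have [z [zP _]] := pbij (dfwith z0 l); exists z.
  by exists (fun i l => sval (h i l)) => i l; apply: (svalP (h i l)).
have qii i l : p i (q i l) = l by rewrite qP dfwith_in.
have qij i j l : i != j -> p j (q i l) = 0 by move=> ne; rewrite qP dfwith_out.
have ql i : linear (q i).
  move=> k x y; apply: inj => j; rewrite linearP /=.
  have [<-|ne] := eqVneq i j; first by rewrite !qii.
  by rewrite !qij // scaler0 addr0.
have qM i z l : z * q i l = q i (p i z * l).
  apply: inj => j; rewrite rmorphM /=.
  have [<-|ne] := eqVneq i j; first by rewrite !qii.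
  by rewrite !qij // mulr0.
have Zcomm (z z' : Z) : z * z' = z' * z by apply: val_inj; apply: Zc.
have q1 : \sum_i q i 1 = 1.
  apply: inj => j; rewrite rmorph1 rmorph_sum (bigD1 j) //= qii big1 ?addr0 //.
  by move=> i ne; apply: qij.
have [s sP] : exists s : forall i, seq (L i * L i), forall i, sep_family (s i).
  have h i : {s : seq (L i * L i) | sep_family s}.
    by apply: cid; apply: separable_field_family.
  by exists (fun i => sval (h i)) => i; apply: (svalP (h i)).
pose v i (x : L i) : A := val (q i x).
have vl i : linear (v i) by move=> k x y; rewrite /v ql.
pose S := flatten [seq [seq (v i x.1, v i x.2) | x <- s i] | i <- enum 'I_n].
have SE (U : zmodType) (b : A * A -> U) : \sum_(x <- S) b x =
    \sum_i \sum_(x <- s i) b (v i x.1, v i x.2).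
  by rewrite big_flatten big_map big_enum; apply: eq_bigr => i _; rewrite big_map.
exists n, (fun i => v i 1), S; split; split.
- by rewrite -Z1 -q1 -(linear_sum (vsval : {linear Z -> A})).
- by move=> i; apply: Zc.
- by move=> i; rewrite -[LHS]/(val (q i 1 * q i 1)) qM qii mulr1.
- move=> i z /cZ zZ; pose w : Z := Subvs zZ.
  have -> : z * v i 1 = val (q i (p i w)) by rewrite -[p i w]mulr1 -qM.
  have [-> |pw0 _] := eqVneq (p i w) 0.
    by rewrite (lin0 (ql i)) eqxx.
  exists (v i (p i w)^-1); first exact: Zc.
  by rewrite -[z]/(val w) -[_ * _]/(val (w * q i (p i w)^-1)) qM divff.
- move=> x /flattenP[y /mapP[i _ ->] /mapP[u _ ->]].
  by split; apply: Zc.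
- rewrite SE /= -Z1 -q1 (linear_sum (vsval : {linear Z -> A})).
  apply: eq_bigr => i _ /=; rewrite -(sP i).1 (lin_sum _ _ _ (ql i)) linear_sum.
  by apply: eq_bigr => x _; rewrite -[in RHS](qii i x.1) -qM.
move=> z /cZ zZ; pose w : Z := Subvs zZ.
have vM i x : z * v i x = v i (p i w * x).
  by rewrite /v -qM.
rewrite /balanced !SE; apply: eq_bigr => i _ /=.
under eq_bigr do rewrite vM.
rewrite (balanced_lift (b := fun x y => tens (v i x) (v i y)) ((sP i).2 (p i w))).
- by apply: eq_bigr => x _; rewrite mulrC -vM -(Zc w).
- by move=> x k y y'; rewrite vl tens_linearr.
by move=> x k y y'; rewrite vl tens_linearl.
Qed.
End SeparableAlgebra.

Section SeparableIdempotent.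
Variables (F : fieldType) (A : falgType F).
Hypothesis sepA : separable_algebra A.

Let sandwich (s : seq (A * A)) c := \sum_(p <- s) p.1 * c * p.2.

Let sandwich_linear s : linear (sandwich s).
Proof.
move=> k x y; rewrite /sandwich scaler_sumr -big_split; apply: eq_bigr => p _.
by rewrite mulrDr mulrDl -scalerAr -scalerAl.
Qed.

Let X (i : 'I_(\dim {:A})) : A := (vbasis {:A})`_i.

(* The tuples (\sum_p p.1 x_j p.2)_j, for x a basis of A, form a sub-bimodule
   of A^n, to which [central_coordinates] applies; since Z(A) is a product of
   fields, the value at 1 can be normalised in each factor. *)
Lemma central_sandwich : exists s : seq (A * A),
  (forall c, central (\sum_(p <- s) p.1 * c * p.2)) /\
  \sum_(p <- s) p.1 * p.2 = 1.
Proof.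
have ssA := sepA.1.
have [n [e [sZ [[e1 ec ee einv] _]]]] := separable_center sepA.
have X0 y : (forall j, X j * y = 0) -> y = 0.
  move=> Xy; rewrite -[y]mul1r (coord_vbasis (memvf 1)) mulr_suml big1 // => j _.
  by rewrite -scalerAl Xy scaler0.
have loc i : exists s, (forall c, central (sandwich s c)) /\ sandwich s 1 = e i.
  have [ei0|ei0] := eqVneq (e i) 0.
    exists [::]; rewrite /sandwich big_nil ei0; split=> // c a.
    by rewrite /sandwich big_nil mul0r mulr0.
  pose P (f : {ffun 'I_(\dim {:A}) -> A}) := exists s, forall j, f j = sandwich s (X j) * e i.
  have P0 : P 0 by exists [::] => j; rewrite /sandwich big_nil ffunE mul0r.
  have PD k f g : P f -> P g -> P (k *: f + g).
    move=> [s fs] [t gt]; exists ([seq (k *: p.1, p.2) | p <- s] ++ t) => j.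
    rewrite /sandwich big_cat big_map mulrDl !ffunE fs gt; congr (_ + _).
    rewrite scalerAl scaler_sumr; congr (_ * _); apply: eq_bigr => p _ /=.
    by rewrite -!scalerAl.
  have Pl a f : P f -> P [ffun j => a * f j].
    move=> [s fs]; exists [seq (a * p.1, p.2) | p <- s] => j.
    rewrite ffunE fs mulrA /sandwich big_map mulr_sumr; congr (_ * _).
    by apply: eq_bigr => p _ /=; rewrite !mulrA.
  have Pr a f : P f -> P [ffun j => f j * a].
    move=> [s fs]; exists [seq (p.1, p.2 * a) | p <- s] => j.
    rewrite ffunE fs -mulrA -ec mulrA /sandwich big_map mulr_suml; congr (_ * _).
    by apply: eq_bigr => p _ /=; rewrite !mulrA.
  (* The starting tuple comes from the one-term family (1, 1). It is nonzero, since only 0 is killed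
     by every basis vector. *)
  have [||g [[s gs] g0 gc]] := central_coordinates ssA P0 PD Pl Pr (f := [ffun j => X j * e i]).
  - by exists [:: (1, 1)] => j; rewrite /sandwich big_seq1 /= mul1r mulr1 ffunE.
  - apply: contraNneq ei0 => /ffunP h; apply/eqP/X0 => j.
    by have := h j; rewrite !ffunE.
  have sc c : central (sandwich s c * e i).
    move=> a; rewrite (coord_vbasis (memvf c)) (lin_sum _ _ _ (sandwich_linear s)).
    rewrite !(mulr_suml, mulr_sumr); apply: eq_bigr => j _.
    rewrite (linZ _ _ (sandwich_linear s)) -!scalerAl -scalerAr; congr (_ *: _).
    by rewrite -/(X j) -gs gc.
  have [j gj] : exists j, g j != 0.
    apply/existsP; apply: contraNT g0; rewrite negb_exists => /forallP h.
    by apply/eqP/ffunP=> j; rewrite ffunE; apply/eqP; rewrite -[_ == _]negbK.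
  have gje : g j * e i = g j by rewrite gs -mulrA ee.
  have [|z' z'c zz'] := einv i (g j) (fun a => gc j a); first by rewrite gje.
  (* Putting x_j in front of [p.2] replaces the argument c by c x_j; thus 1 is sent to g j z' = e i,
     and the values remain central. *)
  exists [seq (p.1, X j * p.2 * e i * z') | p <- s].
  have E c : sandwich [seq (p.1, X j * p.2 * e i * z') | p <- s] c =
      sandwich s (c * X j) * e i * z'.
    rewrite /sandwich big_map !mulr_suml; apply: eq_bigr => p _ /=.
    by rewrite !mulrA.
  split=> [c a|]; last by rewrite E mul1r -gs.
  by rewrite E mulrA sc -mulrA z'c mulrA.
have [t tP] : exists t : 'I_n -> seq (A * A), forall i,
    (forall c, central (sandwich (t i) c)) /\ sandwich (t i) 1 = e i.
  by exists (fun i => sval (cid (loc i))) => i; apply: (svalP (cid (loc i))).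
exists (flatten [seq t i | i <- enum 'I_n]); split=> [c a|].
  rewrite big_flatten big_map big_enum /= mulr_sumr mulr_suml.
  by apply: eq_bigr => i _; apply: (tP i).1.
rewrite big_flatten big_map big_enum /= -e1; apply: eq_bigr => i _.
by rewrite -(tP i).2; apply: eq_bigr => p _; rewrite mulr1.
Qed.

(* Composing [central_sandwich] with the idempotent u of Z(A) gives the
   idempotent of A: the failure v - w of a (x) 1 = 1 (x) a lies in the
   sub-bimodule P of those elements of A (x)_Z(A) A killed by every
   x (x) y |-> x c y, and P = 0 by [central_coordinates]. *)
Lemma separable_family : exists s : seq (A * A), sep_family s.
Proof.
have ssA := sepA.1.
have [n [e [u [_ [uc u1 ub]]]]] := separable_center sepA.
have [s [sc s1]] := central_sandwich.
pose S := [seq (p.1 * q.1, q.2 * p.2) | p <- s, q <- u].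
have SE (U : zmodType) (b : A * A -> U) :
    \sum_(p <- S) b p = \sum_(p <- s) \sum_(q <- u) b (p.1 * q.1, q.2 * p.2).
  by rewrite big_allpairs_dep.
have u1c c : \sum_(q <- u) q.1 * c * q.2 = c.
  rewrite -[RHS]mul1r -u1 mulr_suml big_seq [RHS]big_seq.
  by apply: eq_bigr => q /uc[_ q2]; rewrite -!mulrA q2.
exists S; split.
  rewrite SE -s1; apply: eq_bigr => p _ /=.
  rewrite -{2}[p.1]mulr1 -u1 mulr_sumr mulr_suml; apply: eq_bigr => q _.
  by rewrite !mulrA.
move=> a; rewrite /balanced !SE /=; set v := LHS; set w := RHS.
apply/eqP; rewrite -subr_eq0; apply: contraT => vw0.
pose Lam c := tens_lift (X := A) (fun x y : A => x * c * y).
pose Psi z := tens_lift (X := A) (fun x y : A => tens (x * z) y).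
have Lamb c : (forall x, linear (fun y : A => x * c * y)) /\
    (forall y, linear (fun x : A => x * c * y)).
  split=> x k y y'; first by rewrite mulrDr -scalerAr.
  by rewrite !mulrDl -!scalerAl.
have Laml c : linear (Lam c) by apply: tens_lift_linear; apply: (Lamb c).1.
have Psil z : linear (Psi z) by apply: tens_lift_linear => x; apply: tens_linearr.
have LamE c x y : Lam c (tens x y) = x * c * y by rewrite /Lam tens_liftE //; apply Lamb.
have PsiE z x y : Psi z (tens x y) = tens (x * z) y.
  rewrite /Psi tens_liftE //; first by move=> x'; apply: tens_linearr.
  by move=> y' k x1 x2; rewrite mulrDl -scalerAl tens_linearl.
(* The condition on [Psi] says that central elements cross the tensor sign; it cuts out a copy of A
   (x)_Z(A) A inside A (x)_F A, onto which [u] projects. *)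
pose P (g : {ffun 'I_(\dim {:A}) -> A}) := (forall c, Lam c g = 0) /\
  forall z, central z -> Psi z g = lmulf z g.
have P0 : P 0.
  split=> [c|z _]; first exact: lin0 (Laml c).
  by rewrite (lin0 (Psil z)) (lin0 (lmulf_linear z)).
have PD k f g : P f -> P g -> P (k *: f + g).
  move=> [f1 f2] [g1 g2]; split=> [c|z zc].
    by rewrite Laml f1 g1 scaler0 addr0.
  by rewrite Psil f2 // g2 // lmulf_linear.
have Pl b f : P f -> P (lmulf b f).
  move=> [f1 f2]; split=> [c|z zc].
    rewrite -(f1 (c * b)); apply: eq_bigr => i _.
    by rewrite !ffunE !mulrA.
  have -> : Psi z (lmulf b f) = lmulf b (Psi z f).
    rewrite /Psi /tens_lift (lin_sum _ _ _ (lmulf_linear b)).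
    by apply: eq_bigr => i _; rewrite lmulf_tens ffunE.
  rewrite f2 //; apply/ffunP => i; rewrite !ffunE.
  by rewrite !mulrA zc.
have LamR c b f : Lam c (rmulf b f) = Lam c f * b.
  rewrite /Lam /tens_lift mulr_suml.
  by apply: eq_bigr => i _; rewrite !ffunE !mulrA.
have PsiR z b f : Psi z (rmulf b f) = rmulf b (Psi z f).
  rewrite /Psi /tens_lift (lin_sum _ _ _ (rmulf_linear b)).
  by apply: eq_bigr => i _; rewrite rmulf_tens ffunE.
have rlmulf b z (f : {ffun 'I_(\dim {:A}) -> A}) : rmulf b (lmulf z f) = lmulf z (rmulf b f).
  by apply/ffunP => i; rewrite !ffunE mulrA.
have Pr b f : P f -> P (rmulf b f).
  move=> [f1 f2]; split=> [c|z zc]; first by rewrite LamR f1 mul0r.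
  by rewrite PsiR f2 // rlmulf.
(* [V x] is x times the family, so v = V a and w = (V 1) a. [Lam c] absorbs [u] and leaves the
   central value of the sandwich at c; hence it agrees on v and w. *)
pose V x := \sum_(p <- s) \sum_(q <- u) tens (x * p.1 * q.1) (q.2 * p.2).
have VLam x c : Lam c (V x) = x * sandwich s c.
  rewrite (lin_sum _ _ _ (Laml c)) mulr_sumr; apply: eq_bigr => p _.
  rewrite (lin_sum _ _ _ (Laml c)) -{2}[c]u1c !(mulr_sumr, mulr_suml).
  by apply: eq_bigr => q _; rewrite LamE !mulrA.
have VPsi x z : central z -> Psi z (V x) = lmulf z (V x).
  move=> zc; rewrite (lin_sum _ _ _ (Psil z)) (lin_sum _ _ _ (lmulf_linear z)).
  apply: eq_bigr => p _.
  rewrite (lin_sum _ _ _ (Psil z)) (lin_sum _ _ _ (lmulf_linear z)).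
  rewrite (eq_bigr (fun q => tens (x * p.1 * (z * q.1)) (q.2 * p.2))) => [|q _]; last first.
    by rewrite PsiE -(mulrA _ _ z) zc.
  rewrite (balanced_lift (b := fun y y' => tens (x * p.1 * y) (y' * p.2)) (ub z zc)).
  - by apply: eq_bigr => q _; rewrite lmulf_tens mulrA zc.
  - by move=> y k y1 y2; rewrite mulrDl -scalerAl tens_linearr.
  - by move=> y k y1 y2; rewrite mulrDr -scalerAr tens_linearl.
have wE : w = rmulf a (V 1).
  rewrite (lin_sum _ _ _ (rmulf_linear a)); apply: eq_bigr => p _.
  rewrite (lin_sum _ _ _ (rmulf_linear a)); apply: eq_bigr => q _.
  by rewrite rmulf_tens mul1r.
have vE : v = V a.
  by apply: eq_bigr => p _; apply: eq_bigr => q _; rewrite mulrA.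
have Pvw : P (v - w).
  rewrite vE wE addrC -scaleN1r; split=> [c|z zc].
    by rewrite Laml LamR !VLam mul1r scaleN1r -sc addNr.
  by rewrite Psil PsiR !VPsi // lmulf_linear rlmulf.
have [g [[g1 g2] g0 gc]] := central_coordinates ssA P0 PD Pl Pr Pvw vw0.
case/eqP: g0.
(* Write g = \sum_i x_i (x) g_i with central g_i. Inserting [u] and moving g_i through it yields
   (\sum_i x_i g_i) u, where the bracket is [Lam 1 g] = 0. *)
have -> : g = \sum_(q <- u) lmulf q.2 (Psi q.1 g).
  rewrite big_seq (eq_bigr (fun q => lmulf (q.2 * q.1) g)) => [|q /uc[q1 q2]].
    rewrite -big_seq; apply/ffunP=> i; rewrite sum_ffunE.
    under eq_bigr do rewrite ffunE.
    rewrite -mulr_suml big_seq (eq_bigr (fun q => q.1 * q.2)) => [|q /uc[q1 _]].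
      by rewrite -big_seq u1 mul1r.
    exact: q1.
  by rewrite g2 //; apply/ffunP=> i; rewrite !ffunE mulrA.
transitivity (\sum_(q <- u) tens (Lam 1 g * q.1) q.2 : {ffun 'I_(\dim {:A}) -> A}); last first.
  by rewrite g1 big1 // => q _; rewrite mul0r tens0l.
transitivity (\sum_(i < \dim {:A}) \sum_(q <- u) tens (X i * q.1) (q.2 * g i)).
  rewrite exchange_big; apply: eq_big_seq => q /uc[_ q2].
  rewrite /Psi /tens_lift (lin_sum _ _ _ (lmulf_linear _)).
  by apply: eq_bigr => i _; rewrite lmulf_tens.
transitivity (\sum_(i < \dim {:A}) \sum_(q <- u) tens (X i * (g i * q.1)) q.2).
  apply: eq_bigr => i _.
  rewrite (balanced_lift (b := fun y y' => tens (X i * y) y') (ub (g i) (gc i))) //.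
  - by move=> y; apply: tens_linearr.
  - by move=> y k y1 y2; rewrite mulrDr -scalerAr tens_linearl.
rewrite exchange_big; apply: eq_bigr => q _.
rewrite /Lam /tens_lift mulr_suml (lin_sum _ _ _ (tens_linearl q.2)).
by apply: eq_bigr => i _; rewrite mulr1 !mulrA.
Qed.
End SeparableIdempotent.

(** * Semisimplicity of bimodules *)

(** The image of an idempotent is again one; this passes separability from B to its simple
    factors. *)
Lemma sep_family_quotient (F : fieldType) (A B : falgType F) (f : 'AHom(A, B)) :
    (forall b, exists a, f a = b) ->
  (exists s : seq (A * A), sep_family s) -> exists s : seq (B * B), sep_family s.
Proof.
move=> fonto [s [s1 sb]]; exists [seq (f p.1, f p.2) | p <- s]; split.
  rewrite big_map -(rmorph1 f) -s1 rmorph_sum.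
  by apply: eq_bigr => p _; rewrite rmorphM.
move=> b; have [a <-] := fonto b; rewrite /balanced !big_map /=.
under eq_bigr do rewrite -rmorphM.
rewrite (balanced_lift (b := fun x y => tens (f x) (f y)) (sb a)).
- by apply: eq_bigr => p _; rewrite rmorphM.
- by move=> x k y y'; rewrite linearP tens_linearr.
- by move=> x k y y'; rewrite linearP tens_linearl.
Qed.

Section Modules.
Variables (F : fieldType) (M : vectType F).

Definition left_action (R : falgType F) (act : 'Hom(R, 'End(M))) :=
  (forall m, act 1 m = m) /\ forall x y m, act (x * y) m = act x (act y m).

Definition right_action (R : falgType F) (act : 'Hom(R, 'End(M))) :=
  (forall m, act 1 m = m) /\ forall x y m, act (x * y) m = act y (act x m).

Definition stable (R : falgType F) (act : 'Hom(R, 'End(M))) (N : {vspace M}) :=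
  forall x m, m \in N -> act x m \in N.

Lemma actionD (R : falgType F) (act : 'Hom(R, 'End(M))) m :
  linear (fun x => act x m).
Proof. by move=> k x y; rewrite linearP add_lfunE scale_lfunE. Qed.

(** The complement grows by one vector m at a time: the x with x m in N + C form a left ideal, and
    the image under x |-> x m of a complementary left ideal is added to C. *)
Lemma left_complement (X : falgType F) (act : 'Hom(X, 'End(M))) N :
    semisimple_algebra X -> left_action act -> stable act N ->
  exists C, [/\ stable act C, (N :&: C = 0)%VS & (N + C = fullv)%VS].
Proof.
move=> ssX [act1 actM] Nst.
have step (s : seq M) : exists C,
    [/\ stable act C, (N :&: C = 0)%VS & forall m, m \in s -> m \in (N + C)%VS].
  elim: s => [|m s [C [Cst NC0 sC]]].
    exists 0%VS; split=> // [x m|]; last exact: capv0.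
    by rewrite memv0 => /eqP ->; rewrite linear0 mem0v.
  have NCst x n : n \in (N + C)%VS -> act x n \in (N + C)%VS.
    move=> /memv_addP[u uN [v vC ->]].
    by rewrite linearD memv_add ?Nst ?Cst.
  pose ev : 'Hom(X, M) := linfun (fun x => act x m).
  have evE x : ev x = act x m by rewrite linfunE //; apply: actionD.
  pose U := (ev @^-1: (N + C))%VS.
  have Uid : left_ideal U.
    apply/left_idealP => a u; rewrite -!memv_preim !evE actM; exact: NCst.
  have [U' [U'id UU'0 UU'f]] := ssX _ Uid; have /left_idealP U'm := U'id.
  have evU' : ((N + C) :&: (ev @: U') = 0)%VS.
    apply: cap0vP => v vNC /memv_imgP[u uU' vE].
    have u0 : u = 0 by apply: (memv_0cap UU'0); rewrite // -memv_preim -vE.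
    by rewrite vE u0 linear0.
  exists (C + ev @: U')%VS; split=> [x _ /memv_addP[c cC [_ /memv_imgP[u uU' ->] ->]]||].
  - rewrite linearD memv_add ?Cst //= evE -actM -evE memv_img //.
    exact: U'm.
  - apply: cap0vP => n nN /memv_addP[c cC [w wU' nE]].
    have w0 : w = 0.
      apply: (memv_0cap evU') => //.
      have -> : w = n - c by rewrite nE addrC addKr.
      by rewrite memv_add // memvN.
    by apply: (memv_0cap NC0) => //; rewrite nE w0 addr0.
  - move=> m'; rewrite inE addvA => /orP[/eqP->|/sC]; last first.
      by apply/subvP/addvSl.
    have := memvf (1 : X); rewrite -UU'f => /memv_addP[u uU [u' u'U' e1]].
    rewrite -[m]act1 -evE e1 linearD memv_add ?memv_img //.
    by rewrite memv_preim.
have [C [Cst NC0 CP]] := step (vbasis {:M}); exists C; split=> //.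
by apply/eqP; rewrite eqEsubv subvf -(span_basis (vbasisP {:M})); apply/span_subvP.
Qed.

(** Semisimplicity of [X] gives an X-linear projection to [N]. Averaging it over the idempotent of
    [Y] makes it Y-linear, and keeps it X-linear because the actions commute; its kernel is the
    complement. *)
Lemma bimodule_complement (X Y : falgType F)
    (actX : 'Hom(X, 'End(M))) (actY : 'Hom(Y, 'End(M))) N :
    semisimple_algebra X -> (exists s : seq (Y * Y), sep_family s) ->
    left_action actX -> right_action actY ->
    (forall x y m, actY y (actX x m) = actX x (actY y m)) ->
    stable actX N -> stable actY N ->
  exists C, [/\ stable actX C, stable actY C,
                (N :&: C = 0)%VS & (N + C = fullv)%VS].
Proof.
move=> ssX [s [s1 sb]] aX [Y1 YM] XY NX NY.
have [C [CX NC0 NCf]] := left_complement ssX aX NX.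
pose pr := daddv_pi N C.
have prN m : pr m \in N by apply: memv_pi.
have prid n : n \in N -> pr n = n by apply: daddv_pi_id.
have prC c : c \in C -> pr c = 0.
  move=> cC; have := daddv_pi_add NC0 (w := c); rewrite NCf memvf => /(_ isT).
  rewrite [daddv_pi C N c]daddv_pi_id 1?capvC // => /(canRL (addrK _)).
  by rewrite subrr.
have prX x m : pr (actX x m) = actX x (pr m).
  have := memvf m; rewrite -NCf => /memv_addP[n nN [c cC ->]].
  rewrite !linearD /= (prC c) // (prC (actX x c)) ?CX //.
  by rewrite (prid n) // prid ?NX // linear0 !addr0.
(* For a right action [p.1] acts before [p.2], so that on [N] the average is the action of \sum p.1
   p.2 = 1. *)
pose q : 'End(M) := \sum_(p <- s) (actY p.2 \o pr \o actY p.1)%VF.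
have qE m : q m = \sum_(p <- s) actY p.2 (pr (actY p.1 m)).
  by rewrite sum_lfunE; apply: eq_bigr => p _; rewrite !comp_lfunE.
have qN m : q m \in N by rewrite qE memv_suml // => p _; rewrite NY.
have qid n : n \in N -> q n = n.
  move=> nN; rewrite qE -[RHS]Y1 -s1 (lin_sum _ _ _ (actionD actY n)).
  by apply: eq_bigr => p _; rewrite prid ?NY // YM.
have qX x m : q (actX x m) = actX x (q m).
  by rewrite !qE linear_sum; apply: eq_bigr => p _; rewrite XY prX XY.
have qY y m : q (actY y m) = actY y (q m).
  rewrite !qE linear_sum.
  under eq_bigr do rewrite -YM.
  rewrite (balanced_lift (b := fun a b => actY b (pr (actY a m))) (sb y)).
  - by apply: eq_bigr => p _; rewrite YM.
  - by move=> a; apply: actionD.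
  - by move=> b k a a'; rewrite actionD !linearP.
exists (lker q); split.
- by move=> x m; rewrite !memv_ker qX => /eqP->; rewrite linear0.
- by move=> y m; rewrite !memv_ker qY => /eqP->; rewrite linear0.
- by apply: cap0vP => n nN; rewrite memv_ker qid // => /eqP.
apply: fullvP => m; rewrite -[m](subrK (q m)) addrC memv_add //.
by rewrite memv_ker linearB /= [q (q m)]qid // subrr.
Qed.

End Modules.

(** * Finiteness of the orbit set *)

Section SimpleSummands.
Variables (F : fieldType) (W : vectType F) (stab : {vspace W} -> Prop).
Hypothesis stabI : forall U V, stab U -> stab V -> stab (U :&: V)%VS.
Hypothesis stabD : forall U V, stab U -> stab V -> stab (U + V)%VS.
Hypothesis stab0 : stab 0%VS.
Hypothesis stab_compl : forall U, stab U ->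
  exists C, [/\ stab C, (U :&: C = 0)%VS & (U + C = fullv)%VS].

Definition minimal_stable S :=
  [/\ stab S, S <> 0%VS & forall U, stab U -> (U <= S)%VS -> U = 0%VS \/ U = S].

(** Split off a nonzero stable subspace of least dimension; by the modular law the rest of [U] is
    its intersection with a complement, of smaller dimension. *)
Lemma sum_of_minimal U : stab U ->
  exists s : seq {vspace W}, (forall S, S \in s -> minimal_stable S) /\
    U = (\sum_(S <- s) S)%VS.
Proof.
have [n] := ubnP (\dim U); elim: n U => // n IH U /ltnSE leUn stU.
have [U0|/eqP U0] := eqVneq U 0%VS; first by exists [::]; rewrite big_nil.
pose Q m := `[< exists S, [/\ stab S, S <> 0%VS, (S <= U)%VS & \dim S = m] >].
have exQ : exists m, Q m by exists (\dim U); apply/asboolP; exists U; rewrite subvv.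
case: (ex_minnP exQ) => m /asboolP[S [stS S0 SU dS]] mmin.
have Smin : minimal_stable S.
  split=> // V stV VS; have [->|/eqP V0] := eqVneq V 0%VS; [by left | right].
  apply/eqP; rewrite eqEdim VS dS mmin //; apply/asboolP; exists V.
  by split=> //; apply: subv_trans SU.
have [C [stC SC0 SCf]] := stab_compl stS.
have UE : U = (S + (U :&: C))%VS.
  by rewrite capvC vspace_modl // SCf capfv.
have UC0 : (S :&: (U :&: C) = 0)%VS.
  by rewrite capvC -capvA [(C :&: S)%VS]capvC SC0 capv0.
have [|s [sS UCs]] := IH (U :&: C)%VS _ (stabI stU stC).
  apply: leq_trans leUn; rewrite [X in (_ < \dim X)%N]UE dimv_disjoint_sum //.
  by rewrite -[X in (X < _)%N]add0n ltn_add2r lt0n dimv_eq0; apply/eqP.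
exists (S :: s); split=> [V|]; last by rewrite big_cons -UCs.
by rewrite inE => /orP[/eqP->|/sS].
Qed.

(** Greedy choice: a simple S is kept if it meets N + V trivially, and otherwise lies in N + V by
    minimality. Recording the choice as a bit tuple leaves only finitely many possible
    complements. *)
Lemma complement_mask (s : seq {vspace W}) N :
    (forall S, S \in s -> minimal_stable S) -> stab N ->
  exists m : (size s).-tuple bool, let V := (\sum_(S <- mask m s) S)%VS in
    [/\ stab V, (N :&: V = 0)%VS & (\sum_(S <- s) S <= N + V)%VS].
Proof.
move=> sS stN; elim: s sS => [|S s IH] sS /=.
  by exists [tuple]; rewrite /= !big_nil; split; rewrite ?capv0 ?sub0v.
have [m [stV NV0 sNV]] := IH (fun T Ts => sS T (mem_behead (s := S :: s) Ts)).
set V := (\sum_(S <- mask m s) S)%VS in stV NV0 sNV.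
have [stS S0 Smin] := sS S (mem_head _ _).
have [SNV0|SNV] := Smin _ (stabI stS (stabD stN stV)) (capvSl _ _).
  exists [tuple of true :: m]; rewrite /= !big_cons -/V; split.
  - exact: stabD.
  - apply: cap0vP => n nN /memv_addP[x xS [v vV nE]].
    have x0 : x = 0.
      apply: (memv_0cap SNV0) => //; have -> : x = n - v by rewrite nE addrK.
      by rewrite memv_add // memvN.
    by apply: (memv_0cap NV0) => //; rewrite nE x0 add0r.
  - rewrite subv_add (subv_trans (addvSl S V) (addvSr _ _)) /=.
    by apply: subv_trans sNV _; rewrite addvS ?subvv ?addvSr.
exists [tuple of false :: m]; rewrite /= !big_cons -/V; split=> //.
by rewrite subv_add sNV andbT -SNV capvSr.
Qed.

End SimpleSummands.

(** * Quotients of the free bimodule *)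

Section FreeBimodule.
Variables (F : fieldType) (X Y : falgType F).
Notation W := {ffun 'I_(\dim {:X}) -> Y}.

Lemma tens_eq (V : lmodType F) (f g : W -> V) : linear f -> linear g ->
  (forall x y, f (tens x y) = g (tens x y)) -> f =1 g.
Proof.
move=> fl gl fg w; rewrite (tens_gen w) (lin_sum _ _ _ fl) (lin_sum _ _ _ gl).
by apply: eq_bigr.
Qed.

Definition tens_lact : 'Hom(X, 'End(W)) :=
  linfun (fun x => linfun (tens_lift (fun x' y => tens (x * x') y))).

Definition tens_ract : 'Hom(Y, 'End(W)) := linfun (fun y => linfun (@rmulf F X Y y)).

Lemma tens_lactE x x' y : tens_lact x (tens x' y) = tens (x * x') y.
Proof.
rewrite bilinfunE.
- rewrite tens_liftE // => [u|u]; first exact: tens_linearr.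
  by move=> k a a'; rewrite mulrDr -scalerAr tens_linearl.
- by move=> u; apply: tens_lift_linear => u'; apply: tens_linearr.
move=> w k u v; rewrite /tens_lift scaler_sumr -big_split.
by apply: eq_bigr => i _; rewrite mulrDl -scalerAl tens_linearl.
Qed.

Lemma tens_ractE y w : tens_ract y w = rmulf y w.
Proof.
rewrite bilinfunE // => [a|b]; first exact: rmulf_linear.
by move=> k u v; apply/ffunP=> i; rewrite !ffunE mulrDr -scalerAr.
Qed.

Lemma tens_left_action : left_action tens_lact.
Proof.
split=> [m|x y m].
  apply: (tens_eq (f := tens_lact 1) (g := idfun)) => // [k u v|x y].
    by rewrite linearP.
  by rewrite tens_lactE mul1r.
apply: (tens_eq (f := tens_lact (x * y)) (g := fun m => tens_lact x (tens_lact y m))).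
- by move=> k u v; rewrite linearP.
- by move=> k u v; rewrite !linearP.
by move=> u v; rewrite !tens_lactE mulrA.
Qed.

Lemma tens_right_action : right_action tens_ract.
Proof.
split=> [m|x y m]; rewrite !tens_ractE; apply/ffunP=> i; rewrite !ffunE ?mulr1 //.
by rewrite mulrA.
Qed.

Lemma tens_actC x y m : tens_ract y (tens_lact x m) = tens_lact x (tens_ract y m).
Proof.
apply: (tens_eq (f := fun m => tens_ract y (tens_lact x m))
                (g := fun m => tens_lact x (tens_ract y m))).
- by move=> k u v; rewrite !linearP.
- by move=> k u v; rewrite !linearP.
by move=> u v; rewrite !tens_ractE !(tens_lactE, rmulf_tens).
Qed.

Hypothesis ssX : semisimple_algebra X.
Hypothesis sepY : exists s : seq (Y * Y), sep_family s.

(* Each f i identifies V with the quotient of the free bimodule by the kernel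
   of f i, hence with a sum of a subfamily of a fixed finite family of simple
   sub-bimodules. *)
Lemma finitely_many_quotients (I : Type) (V : vectType F) (f : I -> 'Hom(W, V)) :
    (forall i, limg (f i) = fullv) ->
    (forall i, stable tens_lact (lker (f i)) /\ stable tens_ract (lker (f i))) ->
  exists (T : finType) (k : I -> T), forall i j, k i = k j ->
    exists h h' : 'End(V), [/\ cancel h h', cancel h' h,
      (forall x (o o' : V -> V),
        (forall w, f i (tens_lact x w) = o (f i w)) ->
        (forall w, f j (tens_lact x w) = o' (f j w)) ->
        forall v, h (o v) = o' (h v)) &
      (forall y (o o' : V -> V),
        (forall w, f i (tens_ract y w) = o (f i w)) ->
        (forall w, f j (tens_ract y w) = o' (f j w)) ->
        forall v, h (o v) = o' (h v))].
Proof.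
move=> fonto fst.
pose stab N := stable tens_lact N /\ stable tens_ract N.
have stabI (U V' : {vspace W}) : stab U -> stab V' -> stab (U :&: V')%VS.
  move=> [U1 U2] [V1 V2]; split=> x m; rewrite !memv_cap => /andP[mU mV].
    by rewrite U1 ?V1.
  by rewrite U2 ?V2.
have stabD (U V' : {vspace W}) : stab U -> stab V' -> stab (U + V')%VS.
  move=> [U1 U2] [V1 V2]; split=> x m /memv_addP[u uU [v vV ->]].
    by rewrite linearD memv_add ?U1 ?V1.
  by rewrite linearD memv_add ?U2 ?V2.
have stab0 : stab 0%VS.
  by split=> x m; rewrite memv0 => /eqP->; rewrite linear0 mem0v.
have stabC (U : {vspace W}) : stab U ->
    exists C, [/\ stab C, (U :&: C = 0)%VS & (U + C = fullv)%VS].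
  move=> [U1 U2]; have [C [C1 C2 C3 C4]] := bimodule_complement ssX sepY
    tens_left_action tens_right_action tens_actC U1 U2.
  by exists C.
have stabf : stab fullv by split=> x m _; rewrite memvf.
have [s [sS sf]] := sum_of_minimal stabI stabC stabf.
pose vm (m : (size s).-tuple bool) := (\sum_(S <- mask m s) S)%VS.
have km i : {m : (size s).-tuple bool |
    [/\ stab (vm m), (lker (f i) :&: vm m = 0)%VS & (\sum_(S <- s) S <= lker (f i) + vm m)%VS]}.
  by apply: cid; apply: (complement_mask stabI stabD stab0 sS).
(* Equal masks provide one stable subspace complementary to both kernels, as [transport_iso]
   requires. *)
exists ((size s).-tuple bool : finType), (fun i => sval (km i)) => i j ij.
have [[st1 st2] Ni0 Nif] := svalP (km i); have [_ Nj0 Njf] := svalP (km j).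
rewrite -ij in Nj0 Njf; set N := vm _ in st1 st2 Ni0 Nif Nj0 Njf.
have fN l : (lker (f l) :&: N = 0)%VS -> (\sum_(S <- s) S <= lker (f l) + N)%VS ->
    (N :&: lker (f l) = 0)%VS /\ (f l @: N = fullv)%VS.
  rewrite -sf => l0 lf; split; first by rewrite capvC.
  apply/eqP; rewrite eqEsubv subvf -(fonto l) (subv_trans (limgS (f l) lf)) //.
  rewrite limgD subv_add subvv andbT.
  by have := subvv (lker (f l)); rewrite lkerE => /eqP->; apply: sub0v.
have [Ni Nif'] := fN i Ni0 Nif; have [Nj Njf'] := fN j Nj0 Njf.
have [h [h' [hK h'K hP]]] := transport_iso Ni Nif' Nj Njf'.
exists h, h'; split=> // x o o' oP o'P v;
  have : v \in (f i @: N)%VS by rewrite Nif' memvf.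
  by case/memv_imgP=> w wN ->; rewrite -oP !hP ?st1 // o'P.
by case/memv_imgP=> w wN ->; rewrite -oP !hP ?st2 // o'P.
Qed.

End FreeBimodule.

(** * Conjugacy orbits *)

Section Orbits.
Variables (F : fieldType) (A B : falgType F).

Lemma mem_conj_orbit (f g : 'AHom(A, B)) : conj_orbit f g <->
  exists u v : B, [/\ u * v = 1, v * u = 1 & forall a, u * f a = g a * u].
Proof.
split=> [[u uu gE]|[u [v [uv vu fg]]]].
  exists u, u^-1; split=> [||a]; rewrite ?mulrV ?mulVr //.
  by rewrite gE divrK.
have uu : u \is a GRing.unit by apply/unitrP; exists v.
by exists u => // a; rewrite fg mulrK.
Qed.

Lemma conj_orbitP (f g : 'AHom(A, B)) :
  conj_orbit f = conj_orbit g <->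
  exists u v : B, [/\ u * v = 1, v * u = 1 & forall a, u * f a = g a * u].
Proof.
split=> [E|[u [v [uv vu fg]]]].
  apply/mem_conj_orbit; rewrite E; apply/mem_conj_orbit.
  by exists 1, 1; split=> [||a]; rewrite ?mul1r ?mulr1.
apply/seteqP; split=> h /mem_conj_orbit[u' [v' [uv' vu' fh]]]; apply/mem_conj_orbit.
  exists (u' * v), (u * v'); split=> [||a].
  - by rewrite mulrA -(mulrA u') vu mulr1.
  - by rewrite mulrA -(mulrA u) vu' mulr1.
  rewrite mulrA -fh -!mulrA; congr (_ * _).
  by rewrite -[f a * v]mul1r -vu -mulrA [u * (_ * _)]mulrA fg -!mulrA uv mulr1.
exists (u' * u), (v * v'); split=> [||a].
- by rewrite mulrA -(mulrA u') uv mulr1.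
- by rewrite mulrA -(mulrA v) vu' mulr1.
by rewrite -mulrA fg mulrA fh mulrA.
Qed.

(** The orbits are exactly the fibres of the invariant [ty], so x |-> fibre over x is a bijection
    from [P] to the orbits. *)
Lemma orbit_set_fibers (X : Type) (P : set X) (ty : 'AHom(A, B) -> X) :
    (forall f g, conj_orbit f = conj_orbit g <-> ty f = ty g) ->
    (forall f, P (ty f)) -> (forall x, P x -> exists f, ty f = x) ->
  (orbit_set A B #= P)%card.
Proof.
move=> tyE tyP Pty.
have fib f : (fun g => ty g = ty f) = conj_orbit f.
  apply/seteqP; split=> g.
    by move=> /esym /tyE /conj_orbitP /mem_conj_orbit.
  by move=> /mem_conj_orbit /conj_orbitP /tyE.
rewrite card_eq_sym; apply/card_set_bijP; exists (fun x g => ty g = x); split.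
- by move=> x /Pty[f <-]; rewrite fib; exists f.
- move=> x y /set_mem /Pty[f <-] _ /(congr1 (@^~ f)) e.
  by have : ty f = ty f by []; rewrite e.
- by move=> _ [f _ <-]; exists (ty f).
Qed.

(** [f] factors through [k]: [g t] is the union of the [f i] over the fibre of t, all of them equal.
    Taking the union avoids choosing representatives, and covers empty fibres. *)
Lemma finite_range (T : finType) (I U : Type) (k : I -> T) (f : I -> set U) :
  (forall i j, k i = k j -> f i = f j) -> finite_set (range f).
Proof.
move=> kf; pose g t : set U := fun u => exists2 i : I, k i = t & f i u.
apply: (@sub_finite_set _ _ (range g)); last exact/finite_image/finite_finset.
move=> _ [i _ <-]; exists (k i) => //; apply/seteqP; split=> u.
  by case=> j /kf ->.
by exists i.
Qed.

(** The separable algebra must act on the right, so the map is b (x) a |-> b f(a) if A is separable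
    and a (x) b |-> f(a) b if B is. An isomorphism of two such quotients is B-linear on one side,
    hence multiplication by a unit, which conjugates f to g. *)
Lemma finite_orbit_set : semisimple_algebra A -> semisimple_algebra B ->
  separable_algebra A \/ separable_algebra B -> finite_set (orbit_set A B).
Proof.
move=> ssA ssB sepAB.
suff [T [k kP]] : exists (T : finType) (k : 'AHom(A, B) -> T), forall f g, k f = k g ->
    conj_orbit f = conj_orbit g by apply: finite_range kP.
have lin_mul (C : falgType F) (c : C) : linear (fun x => c * x) /\ linear (fun x => x * c).
  by split=> k x y; [rewrite mulrDr scalerAr | rewrite mulrDl scalerAl].
case: sepAB => [/separable_family sep | /separable_family sep].
- pose ev (f : 'AHom(A, B)) := linfun (tens_lift (fun b a => b * f a)).
  have evl (f : 'AHom(A, B)) : (forall b, linear (fun a => b * f a)) /\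
      (forall a, linear (fun b => b * f a)).
    split=> [b k x y|a]; last exact: (lin_mul _ _).2.
    by rewrite linearP mulrDr scalerAr.
  have evE f b a : ev f (tens b a) = b * f a.
    rewrite linfunE; last by apply: tens_lift_linear; apply: (evl f).1.
    by rewrite tens_liftE; [|apply: (evl f).1|apply: (evl f).2].
  have evl' f b w : ev f (tens_lact B A b w) = b * ev f w.
    apply: (tens_eq (f := fun w => ev f (tens_lact B A b w)) (g := fun w => b * ev f w)).
    + by move=> k x y; rewrite !linearP.
    + by move=> k x y; rewrite linearP mulrDr scalerAr.
    by move=> x y; rewrite tens_lactE !evE mulrA.
  have evr f a w : ev f (tens_ract B A a w) = ev f w * f a.
    apply: (tens_eq (f := fun w => ev f (tens_ract B A a w)) (g := fun w => ev f w * f a)).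
    + by move=> k x y; rewrite !linearP.
    + by move=> k x y; rewrite linearP mulrDl scalerAl.
    by move=> x y; rewrite tens_ractE rmulf_tens !evE rmorphM mulrA.
  have [||T [k kP]] := finitely_many_quotients ssB sep (f := ev).
  - move=> f; apply: fullvP => b; rewrite -[b]mulr1 -(rmorph1 f) -evE.
    by rewrite memv_img ?memvf.
  - move=> f; split=> x w; rewrite !memv_ker ?evl' ?evr => /eqP->.
      by rewrite mulr0.
    by rewrite mul0r.
  exists T, k => f g /kP[h [h' [hK h'K hl hr]]]; apply/conj_orbitP.
  have h_l b x : h (b * x) = b * h x.
    exact: (hl b (fun x => b * x) (fun x => b * x)).
  have h1 x : h x = x * h 1 by rewrite -h_l mulr1.
  have h'1 x : h' x = x * h' 1.
    by rewrite -{1}[x]mulr1 -{1}[1]h'K -h_l hK.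
  have h_r a x : h (x * f a) = h x * g a.
    exact: (hr a (fun x => x * f a) (fun x => x * g a)).
  (* Here [h] is right multiplication by [h 1], so the conjugating element is the inverse [h' 1]; in
     the other case it is [h 1]. *)
  exists (h' 1), (h 1); split=> [||a].
  + by rewrite -h1 h'K.
  + by rewrite -h'1 hK.
  by apply: (can_inj hK); rewrite h_r h_l h'K mul1r mulr1.
- pose ev (f : 'AHom(A, B)) := linfun (tens_lift (fun a b => f a * b)).
  have evl (f : 'AHom(A, B)) : (forall a, linear (fun b => f a * b)) /\
      (forall b, linear (fun a => f a * b)).
    split=> [a|b k x y]; first exact: (lin_mul _ _).1.
    by rewrite linearP mulrDl scalerAl.
  have evE f a b : ev f (tens a b) = f a * b.
    rewrite linfunE; last by apply: tens_lift_linear; apply: (evl f).1.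
    by rewrite tens_liftE; [|apply: (evl f).1|apply: (evl f).2].
  have evl' f a w : ev f (tens_lact A B a w) = f a * ev f w.
    apply: (tens_eq (f := fun w => ev f (tens_lact A B a w)) (g := fun w => f a * ev f w)).
    + by move=> k x y; rewrite !linearP.
    + by move=> k x y; rewrite linearP mulrDr scalerAr.
    by move=> x y; rewrite tens_lactE !evE rmorphM mulrA.
  have evr f b w : ev f (tens_ract A B b w) = ev f w * b.
    apply: (tens_eq (f := fun w => ev f (tens_ract A B b w)) (g := fun w => ev f w * b)).
    + by move=> k x y; rewrite !linearP.
    + by move=> k x y; rewrite linearP mulrDl scalerAl.
    by move=> x y; rewrite tens_ractE rmulf_tens !evE mulrA.
  have [||T [k kP]] := finitely_many_quotients ssA sep (f := ev).
  - move=> f; apply: fullvP => b; rewrite -[b]mul1r -(rmorph1 f) -evE.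
    by rewrite memv_img ?memvf.
  - move=> f; split=> x w; rewrite !memv_ker ?evl' ?evr => /eqP->.
      by rewrite mulr0.
    by rewrite mul0r.
  exists T, k => f g /kP[h [h' [hK h'K hl hr]]]; apply/conj_orbitP.
  have h_l a x : h (f a * x) = g a * h x.
    exact: (hl a (fun x => f a * x) (fun x => g a * x)).
  have h_r b x : h (x * b) = h x * b.
    exact: (hr b (fun x => x * b) (fun x => x * b)).
  have h1 x : h x = h 1 * x by rewrite -h_r mul1r.
  have h'1 x : h' x = h' 1 * x.
    by rewrite -{1}[x]mul1r -{1}[1]h'K -h_r hK.
  exists (h 1), (h' 1); split=> [||a].
  + by rewrite -h1 h'K.
  + by rewrite -h'1 hK.
  by rewrite -h1 -[f a]mulr1 h_l.
Qed.

End Orbits.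

(** * The algebra D (x) A^o *)

Section Radical.
Variables (F : fieldType) (T : falgType F).

Lemma division_semisimple : division_algebra T -> semisimple_algebra T.
Proof.
move=> divT U /left_idealP Ul; have [->|U0] := eqVneq U 0%VS.
  exists fullv; split; rewrite ?add0v ?cap0v //.
  by apply/left_idealP => a u _; rewrite memvf.
exists 0%VS; split; rewrite ?capv0 ?addv0 //.
  by apply/left_idealP => a u; rewrite memv0 => /eqP->; rewrite mulr0 mem0v.
apply: fullvP => x; have uu : vpick U \is a GRing.unit by rewrite divT ?vpick0.
by rewrite -(divrK uu x) Ul ?memv_pick.
Qed.

Lemma maximal_left_ideal_exists (U : {vspace T}) : left_ideal U -> U <> fullv ->
  exists2 M, maximal_left_ideal M & (U <= M)%VS.
Proof.
move=> Uid Uf.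
pose Q n := `[< exists M : {vspace T}, [/\ left_ideal M, M <> fullv, (U <= M)%VS & \dim M = n] >].
have exQ : exists n, Q n by exists (\dim U); apply/asboolP; exists U; rewrite subvv.
have bQ n : Q n -> (n <= \dim {:T})%N.
  by move=> /asboolP[M [_ _ _ <-]]; rewrite dimvS ?subvf.
case: (ex_maxnP exQ bQ) => n /asboolP[M [Mid Mf UM dM]] nmax.
exists M => //; split=> // V Vid MV; have [->|/eqP Vf] := eqVneq V fullv; [by right|left].
apply/eqP; rewrite eq_sym eqEdim MV dM nmax //; apply/asboolP; exists V.
by split=> //; apply: subv_trans MV.
Qed.

(** If x = x y x is nonzero, g = y x is a nonzero idempotent, and T (1 - g) lies in a maximal left
    ideal. A radical x would put g, hence 1, in that ideal. *)
Lemma regular_radical0 : (forall x : T, exists y, x * y * x = x) ->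
  forall x : T, jacobson_radical x -> x = 0.
Proof.
move=> reg x Jx; have [y xyx] := reg x; pose g := y * x.
have gg : g * g = g by rewrite /g -mulrA (mulrA x) xyx.
have xg : x * g = x by rewrite mulrA xyx.
apply: contrapT => x0; have g0 : g <> 0 by move=> g0; apply: x0; rewrite -xg g0 mulr0.
have [Nf|M [Mid Mf Mmax] NM] := maximal_left_ideal_exists (left_ideal_line (1 - g)).
  have : 1 \in ({:T} * <[(1 - g)]>)%VS by rewrite Nf memvf.
  case/memv_cosetP=> z _ e1; apply: g0.
  by rewrite -[g]mul1r e1 -mulrA mulrBl mul1r gg subrr mulr0.
have /left_idealP Ml := Mid.
have gM : g \in M by apply: Ml; apply: Jx.
have M1 : 1 \in M.
  by rewrite -[1](subrK g) memvD // (subvP NM) ?mem_left_line.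
by apply: Mf; apply: fullvP => z; rewrite -[z]mulr1 Ml.
Qed.

End Radical.

Section TensorOpp.
Variables (F : fieldType) (D A T : falgType F) (tn : {bilinear D -> A -> T}).
Hypothesis tnP : is_tensor_opp tn.

Lemma tensor_opp_eq (U : lmodType F) (f g : T -> U) : linear f -> linear g ->
  (forall x a, f (tn x a) = g (tn x a)) -> f =1 g.
Proof.
by case/linear_pack=> f' -> /linear_pack[g' ->]; apply: (tensor_ext tnP).
Qed.

Lemma tensor_oppC x a : tn x 1 * tn 1 a = tn x a.
Proof. by rewrite (tensor_mul tnP) !mulr1. Qed.

Lemma tensor_oppC' x a : tn 1 a * tn x 1 = tn x a.
Proof. by rewrite (tensor_mul tnP) !mul1r. Qed.

Lemma tensor_opp_span (N : {vspace T}) : (forall x a, tn x a \in N) -> N = fullv.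
Proof.
move=> tN; apply: fullvP => t.
suff <- : projv N t = t by apply: memv_proj.
apply: (tensor_opp_eq (f := projv N) (g := idfun)) => // [k u v|x a].
  by rewrite linearP.
by rewrite projv_id.
Qed.

Lemma linear_tnl a : linear (tn^~ a).
Proof. by move=> k x y; apply: linearPl. Qed.

Lemma linear_tnr x : linear (tn x).
Proof. by move=> k a b; apply: linearPr. Qed.

(** [bimodule_complement] wants the semisimple factor on the left and the separable one on the
    right. Since A enters reversed, left multiplication makes T a (D, A)-bimodule, whose
    sub-bimodules are left ideals, and right multiplication an (A, D)-bimodule, whose sub-bimodules
    are right ideals. Regularity follows from complements on either side. *)
Lemma tensor_opp_regular :
    (division_algebra D /\ exists s : seq (A * A), sep_family s) \/
    (semisimple_algebra A /\ exists s : seq (D * D), sep_family s) ->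
  forall x : T, exists y, x * y * x = x.
Proof.
move=> h x.
pose actl (t : T) : 'End(T) := linfun (fun w => t * w).
pose actr (t : T) : 'End(T) := linfun (fun w => w * t).
have actlE t w : actl t w = t * w.
  by rewrite linfunE // => k u v; rewrite mulrDr scalerAr.
have actrE t w : actr t w = w * t.
  by rewrite linfunE // => k u v; rewrite mulrDl scalerAl.
have mk (R : falgType F) (f : R -> T) (a : T -> 'End(T)) : linear f -> linear a ->
    {act : 'Hom(R, 'End(T)) | forall r, act r = a (f r)}.
  move=> fl al; exists (linfun (fun r => a (f r))) => r.
  by rewrite linfunE // => k u v; rewrite fl al.
have actll : linear actl.
  move=> k u v; apply/lfunP=> w; rewrite add_lfunE scale_lfunE !actlE.
  by rewrite mulrDl scalerAl.
have actrl : linear actr.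
  move=> k u v; apply/lfunP=> w; rewrite add_lfunE scale_lfunE !actrE.
  by rewrite mulrDr scalerAr.
case: h => [[/division_semisimple ssD sep]|[ssA sep]].
  have [aD aDE] := mk _ _ _ (linear_tnl 1) actll.
  have [aA aAE] := mk _ _ _ (linear_tnr 1) actll.
  suff ssT : semisimple_algebra T.
    have [e /memv_cosetP[y _ ey] xe] := left_ideal_idempotent ssT (left_ideal_line x).
    by exists y; rewrite -mulrA -ey xe // mem_left_line.
  have aDP : left_action aD.
    split=> [m|u v m]; rewrite !aDE !actlE ?(tensor_one tnP) ?mul1r //.
    by rewrite mulrA (tensor_mul tnP) mulr1.
  have aAP : right_action aA.
    split=> [m|u v m]; rewrite !aAE !actlE ?(tensor_one tnP) ?mul1r //.
    by rewrite mulrA (tensor_mul tnP) mulr1.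
  have aDA u a m : aA a (aD u m) = aD u (aA a m).
    by rewrite !aAE !aDE !actlE !mulrA tensor_oppC tensor_oppC'.
  move=> U /left_idealP Ul.
  have [||C [CD CA UC0 UCf]] := bimodule_complement ssD sep aDP aAP aDA (N := U).
  - by move=> u m mU; rewrite aDE actlE Ul.
  - by move=> u m mU; rewrite aAE actlE Ul.
  exists C; split=> //; apply/left_idealP => t c cC; rewrite -actrE memv_preim.
  rewrite (tensor_opp_span (N := (actr c @^-1: C)%VS)) ?memvf // => u a.
  rewrite -memv_preim actrE -tensor_oppC -mulrA.
  by have := CD u _ (CA a _ cC); rewrite aDE aAE !actlE.
have [aD aDE] := mk _ _ _ (linear_tnl 1) actrl.
have [aA aAE] := mk _ _ _ (linear_tnr 1) actrl.
have aAP : left_action aA.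
  split=> [m|u v m]; rewrite !aAE !actrE ?(tensor_one tnP) ?mulr1 //.
  by rewrite -mulrA (tensor_mul tnP) mulr1.
have aDP : right_action aD.
  split=> [m|u v m]; rewrite !aDE !actrE ?(tensor_one tnP) ?mulr1 //.
  by rewrite -mulrA (tensor_mul tnP) mulr1.
have aAD a u m : aD u (aA a m) = aA a (aD u m).
  by rewrite !aAE !aDE !actrE -!mulrA tensor_oppC tensor_oppC'.
pose U := limg (actl x).
have [||C [CA CD UC0 UCf]] := bimodule_complement ssA sep aAP aDP aAD (N := U).
- move=> a _ /memv_imgP[w _ ->]; rewrite aAE actrE actlE -mulrA -actlE.
  by rewrite memv_img ?memvf.
- move=> u _ /memv_imgP[w _ ->]; rewrite aDE actrE actlE -mulrA -actlE.
  by rewrite memv_img ?memvf.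
have Cr c t : c \in C -> c * t \in C.
  move=> cC; rewrite -actlE memv_preim.
  rewrite (tensor_opp_span (N := (actl c @^-1: C)%VS)) ?memvf // => u a.
  rewrite -memv_preim actlE -tensor_oppC mulrA.
  by have := CA a _ (CD u _ cC); rewrite aAE aDE !actrE.
have := memvf (1 : T); rewrite -UCf => /memv_addP[e /memv_imgP[y _ eE] [f fC e1]].
rewrite actlE in eE; exists y; rewrite -eE; apply/eqP; rewrite eq_sym -subr_eq0.
apply/eqP/(memv_0cap UC0).
  by rewrite eE -{1}[x]mulr1 -mulrA -mulrBr -(actlE x) /U memv_img ?memvf.
by rewrite -{1}[x]mul1r -mulrBl e1 [e + f]addrC addrK Cr.
Qed.

End TensorOpp.

Lemma dim_ffun_full (F : fieldType) (S : finType) (V : vectType F) :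
  \dim {: {ffun S -> V}} = (#|S| * \dim {:V})%N.
Proof.
rewrite (dimv_ffun (E := fun=> fullv)) ?sum_nat_const // => f.
by split=> [_ s|_]; rewrite memvf.
Qed.

(* For T = \prod_i Mat_(m i)(D i), [s i d] is d placed in the corner (0, 0) of
   the i-th factor, and the idempotent [s i 1] generates the i-th simple right
   module [s i 1 * T]. *)
Record basic_family (F : fieldType) (T : falgType F) (t : nat)
    (D : 'I_t -> falgType F) (s : forall i, 'Hom(D i, T)) : Prop := {
  basic_mul : forall i d d', s i (d * d') = s i d * s i d';
  basic_inj : forall i, injective (s i);
  basic_corner : forall i x, exists d, s i 1 * x * s i 1 = s i d;
  basic_orth : forall i j x, i != j -> s i 1 * x * s j 1 = 0;
  basic_full : exists c : seq (T * 'I_t * T),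
    \sum_(p <- c) p.1.1 * s p.1.2 1 * p.2 = 1
}.

Section Wedderburn.
Variables (F : fieldType) (T : falgType F) (t : nat).
Variables (D : 'I_t -> falgType F) (m : 'I_t -> nat).
Variable p : forall i, {lrmorphism T -> 'M[D i]_(m i) | in_alg (D i) \; *:%R}.
Hypothesis pP : is_wedderburn p.
Hypothesis rad0 : forall x : T, jacobson_radical x -> x = 0.

Lemma wedderburn_inj x y : (forall i, p i x = p i y) -> x = y.
Proof.
move=> h; apply/eqP; rewrite -subr_eq0; apply/eqP/rad0/(wedderburn_ker pP) => i.
by rewrite rmorphB /= h subrr.
Qed.

Lemma wedderburnZ i k x : p i (k *: x) = (k%:A : D i) *: p i x.
Proof. by rewrite linearZ. Qed.

(** The radical being 0, T is the product of its matrix blocks. The right ideal e_i T is the top row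
    of the i-th block, a row of [m i] entries in [D i]. *)
Lemma wedderburn_basic : exists s : forall i, 'Hom(D i, T), basic_family s /\
  forall i (E : {vspace T}), (forall x, x \in E <-> s i 1 * x = x) ->
    \dim E = (m i * \dim {:D i})%N.
Proof.
pose o i : 'I_(m i) := Ordinal (wedderburn_size pP i).
pose z0 i : 'M[D i]_(m i) := 0.
have [q qP] : exists q : forall i, 'M[D i]_(m i) -> T,
    forall i (y : 'M[D i]_(m i)) j, p j (q i y) = dfwith z0 y j.
  have h i (y : 'M[D i]_(m i)) : {z : T | forall j, p j z = dfwith z0 y j}.
    by apply: cid; apply: (wedderburn_onto pP).
  by exists (fun i y => sval (h i y)) => i y; apply: (svalP (h i y)).
have qii i y : p i (q i y) = y by rewrite qP dfwith_in.
have qij i j y : i != j -> p j (q i y) = 0 by move=> ne; rewrite qP dfwith_out.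
have qM i y z : q i (y * z) = q i y * q i z.
  apply: wedderburn_inj => j; rewrite rmorphM /=.
  have [<-|ne] := eqVneq i j; first by rewrite !qii.
  by rewrite !qij // mulr0.
pose sf i (d : D i) := q i (d *: delta_mx (o i) (o i)).
have sl i : linear (sf i).
  move=> k x y; apply: wedderburn_inj => j; rewrite rmorphD /= wedderburnZ.
  have [<-|ne] := eqVneq i j; last by rewrite !qij // scaler0 addr0.
  by rewrite !qii scalerDl scalerA mulr_algl.
pose s i : 'Hom(D i, T) := linfun (sf i).
have sE i d : s i d = q i (d *: delta_mx (o i) (o i)) by rewrite (linfunE (sl i)).
have dd i : delta_mx (o i) (o i) * delta_mx (o i) (o i) = delta_mx (o i) (o i) :> 'M[D i]_(m i).
  by rewrite -mulmxE mul_delta_mx.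
have corner i (y : 'M[D i]_(m i)) :
    delta_mx (o i) (o i) * y * delta_mx (o i) (o i) = y (o i) (o i) *: delta_mx (o i) (o i).
  apply/matrixP=> a b; rewrite -mulmxE !mxE (bigD1 (o i)) //= big1 => [|c ne].
    rewrite !mxE (bigD1 (o i)) //= big1 => [|c ne]; last by rewrite mxE (negbTE ne) andbF mul0r.
    rewrite !mxE !eqxx !andbT !addr0 /=.
    by case: (a == o i); case: (b == o i); rewrite ?(mul1r, mulr1, mul0r, mulr0).
  by rewrite !mxE (negbTE ne) mulr0.
exists s; split; first split.
- move=> i d d'; rewrite !sE -qM; congr (q i _).
  apply/matrixP=> a b; rewrite -mulmxE !mxE (bigD1 (o i)) //= big1 => [|c ne].
    rewrite !mxE !eqxx !andbT addr0 /=.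
    by case: (a == o i); case: (b == o i); rewrite ?(mulr1, mulr0, mul0r).
  by rewrite !mxE (negbTE ne) andbF mulr0 mul0r.
- move=> i d d'; rewrite !sE => /(congr1 (p i)); rewrite !qii => /matrixP/(_ (o i) (o i)).
  by rewrite !mxE !eqxx !mulr1.
- move=> i x; exists (p i x (o i) (o i)); rewrite !sE.
  apply: wedderburn_inj => j; rewrite !rmorphM /=.
  have [<-|ne] := eqVneq i j; last by rewrite !qij // mulr0.
  by rewrite !qii scale1r corner.
- move=> i j x ne; rewrite !sE; apply: wedderburn_inj => k; rewrite !rmorphM rmorph0 /=.
  have [<-|ne'] := eqVneq i k; last by rewrite qij // !mul0r.
  by rewrite [p i (q j _)]qij ?mulr0 // eq_sym.
(* In matrix units, 1 is the sum over i and a of E_(a,0) e_i E_(0,a). *)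
- exists [seq (q i (delta_mx a (o i)), i, q i (delta_mx (o i) a))
          | i <- enum 'I_t, a <- enum 'I_(m i)].
  rewrite big_allpairs_dep /= big_enum /=; apply: wedderburn_inj => k.
  rewrite rmorph_sum rmorph1 (bigD1 k) //= [X in _ + X]big1 ?addr0 => [|i ne]; last first.
    by rewrite rmorph_sum big1 // => a _; rewrite !rmorphM /= qij // !mul0r.
  rewrite big_enum rmorph_sum /=; apply/matrixP => a b; rewrite summxE.
  rewrite (eq_bigr (fun c => delta_mx c c a b)) => [|c _]; last first.
    by rewrite !rmorphM /= sE !qii scale1r -!mulmxE !mul_delta_mx.
  rewrite (bigD1 a) //= big1 ?addr0 => [|c ne]; first by rewrite !mxE eqxx eq_sym.
  by rewrite !mxE eq_sym (negbTE ne).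
move=> i E EP.
pose g (x : T) : {ffun 'I_(m i) -> D i} := [ffun a => p i x (o i) a].
have gl : linear g.
  move=> k x y; apply/ffunP=> a; rewrite !ffunE rmorphD /= wedderburnZ !mxE.
  by rewrite mulr_algl.
have EP' x : x \in E <-> (forall j, j != i -> p j x = 0) /\ forall a b, a != o i -> p i x a b = 0.
  have ee a b : (delta_mx (o i) (o i) * p i x) a b = (p i x) a b *+ (a == o i).
    rewrite -mulmxE mxE (bigD1 (o i)) //= big1 => [|c ne]; last by rewrite mxE (negbTE ne) andbF mul0r.
    rewrite mxE eqxx andbT addr0; case: eqP => [->|_]; rewrite ?mul1r ?mul0r //.
  split=> [/EP xE|[x1 x2]].
    split=> [j ne|a b ne].
      by rewrite -xE rmorphM /= sE qij ?mul0r // eq_sym.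
    by rewrite -xE rmorphM /= sE qii scale1r ee (negbTE ne).
  apply/EP; apply: wedderburn_inj => j; rewrite rmorphM /= sE.
  have [<-|ne] := eqVneq i j; last by rewrite qij // mul0r x1 // eq_sym.
  rewrite qii scale1r; apply/matrixP=> a b; rewrite ee.
  by have [//|ne] := eqVneq a (o i); rewrite x2.
rewrite -{1}[m i]card_ord -dim_ffun_full; apply: (dimv_bij (f := linfun g)).
  apply: cap0vP => x /EP'[x1 x2]; rewrite memv_ker linfunE // => /eqP/ffunP x0.
  apply: wedderburn_inj => j; rewrite rmorph0.
  have [->|ne] := eqVneq j i; last exact: x1.
  apply/matrixP=> a b; rewrite mxE; have [->|ne] := eqVneq a (o i); last exact: x2.
  by have := x0 b; rewrite !ffunE.
apply: fullvP => y; pose x := q i (\matrix_(a, b) (y b *+ (a == o i))).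
have -> : y = linfun g x.
  by rewrite linfunE //; apply/ffunP=> b; rewrite ffunE qii mxE eqxx.
apply: memv_img; apply/EP'; split=> [j ne|a b ne].
  by rewrite qij // eq_sym.
by rewrite qii mxE (negbTE ne).
Qed.

End Wedderburn.

(** * Modules over a semisimple algebra *)

Section FreeModules.
Variables (F : fieldType) (D : falgType F) (M : vectType F).
Hypothesis divD : division_algebra D.
Variable act : 'Hom(D, 'End(M)).
Hypothesis actM : forall x y m, act (x * y) m = act y (act x m).

(* [act 1] is only required to be the identity on [U], so that [D] may act on M
   through a corner of a larger algebra. *)
Lemma division_free (U : {vspace M}) :
    (forall d u, u \in U -> act d u \in U) -> {in U, forall u, act 1 u = u} ->
  exists (k : nat) (v : 'I_k -> M) (f : 'Hom({ffun 'I_k -> D}, M)),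
    [/\ forall i, v i \in U, forall d, f d = \sum_i act (d i) (v i),
        lker f = 0%VS, limg f = U & \dim U = (k * \dim {:D})%N].
Proof.
move=> Ust U1.
pose fs k (v : 'I_k -> M) (d : {ffun 'I_k -> D}) : M := \sum_i act (d i) (v i).
have fsl k (v : 'I_k -> M) : linear (fs k v).
  move=> c d d'; rewrite /fs scaler_sumr -big_split; apply: eq_bigr => i _.
  by rewrite !ffunE actionD.
pose indep k (v : 'I_k -> M) := (forall i, v i \in U) /\ forall d, fs k v d = 0 -> d = 0.
have fsU k (v : 'I_k -> M) d : (forall i, v i \in U) -> fs k v d \in U.
  by move=> vU; apply: memv_suml => i _; apply: Ust.
have ker0 k (v : 'I_k -> M) : indep k v -> lker (linfun (fs k v)) = 0%VS.
  move=> [_ v0]; apply/eqP; rewrite -subv0; apply/subvP => d.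
  by rewrite memv_ker (linfunE (fsl _ _)) memv0 => /eqP/v0->.
have dimfs k (v : 'I_k -> M) : indep k v -> \dim (limg (linfun (fs k v))) = (k * \dim {:D})%N.
  move=> vi; rewrite limg_dim_eq ?dim_ffun_full ?card_ord //.
  by rewrite ker0 ?capv0.
pose Q k := `[< exists v : 'I_k -> M, indep k v >].
have exQ : exists k, Q k.
  exists 0%N; apply/asboolP; exists (fun=> 0); split=> [[]//|d _].
  by apply/ffunP=> -[].
have bQ k : Q k -> (k <= \dim {:M})%N.
  move=> /asboolP[v /dimfs dv]; have := dimvS (subvf (limg (linfun (fs k v)))).
  rewrite dv; apply: leq_trans; rewrite -{1}[k]muln1 leq_mul2l.
  by rewrite falg_dim_gt0 orbT.
case: (ex_maxnP exQ bQ) => k /asboolP[v vi] kmax.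
exists k, v, (linfun (fs k v)); have [vU v0] := vi.
suff fU : limg (linfun (fs k v)) = U.
  by split=> //; [move=> d; rewrite (linfunE (fsl _ _)) | apply: ker0 | rewrite -fU dimfs].
apply/eqP; rewrite eqEsubv; apply/andP; split.
  by apply/subvP=> _ /memv_imgP[d _ ->]; rewrite (linfunE (fsl _ _)) fsU.
apply/subvP=> u uU; apply: contraT => unot.
(* If u were outside the span of a largest independent family, it could be adjoined as the last
   vector. *)
suff /kmax : Q k.+1 by rewrite ltnn.
apply/asboolP; exists (fun i => if unlift ord_max i is Some j then v j else u).
split=> [i|d].
  by case: unliftP => [j _|_]; [apply: vU|].
rewrite /fs big_ord_recr /= unlift_none => d0.
have lm (i : 'I_k) : unlift ord_max (widen_ord (leqnSn k) i) = Some i.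
  have -> : widen_ord (leqnSn k) i = lift ord_max i.
    by apply: val_inj; rewrite /= /bump leqNgt ltn_ord add0n.
  by rewrite liftK.
(* In a relation, a nonzero coefficient of u could be inverted, which would put u in the span. *)
have dk0 : d ord_max = 0.
  apply: contrapT => /eqP/divD dku; case/negP: unot.
  set w := \sum_(i < k) _ in d0.
  have wE : w = linfun (fs k v) [ffun i => d (widen_ord (leqnSn k) i)].
    by rewrite (linfunE (fsl _ _)); apply: eq_bigr => i _; rewrite lm ffunE.
  have -> : u = linfun (fs k v) (- [ffun i => d (widen_ord (leqnSn k) i) * (d ord_max)^-1]).
    have {1}-> : u = act (d ord_max)^-1 (act (d ord_max) u).
      by rewrite -actM mulrV // U1.
    move/eqP: d0; rewrite addrC addr_eq0 => /eqP->.
    rewrite linearN linearN /= (linfunE (fsl _ _)) /w linear_sum; congr (- _).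
    by apply: eq_bigr => i _; rewrite lm ffunE actM.
  by rewrite memv_img ?memvf.
move: d0; rewrite dk0 linear0 zero_lfunE addr0 => d0.
have /ffunP d'0 : [ffun i => d (widen_ord (leqnSn k) i)] = 0 :> {ffun 'I_k -> D}.
  by apply: v0; rewrite -d0; apply: eq_bigr => i _; rewrite lm ffunE.
apply/ffunP=> i; rewrite ffunE; case: (unliftP ord_max i) => [j ->|->//].
have := d'0 j; rewrite !ffunE => <-; congr (d _).
by apply: val_inj; rewrite /= /bump leqNgt ltn_ord add0n.
Qed.

End FreeModules.

(** * Types of right T-modules *)

Section Classification.
Variables (F : fieldType) (T : falgType F) (t : nat).
Variables (D : 'I_t -> falgType F) (s : forall i, 'Hom(D i, T)).
Hypothesis divD : forall i, division_algebra (D i).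
Hypothesis sP : basic_family s.

Local Notation e i := (s i 1).
Local Notation index x := {i : 'I_t & 'I_(x i)}.
Local Notation Std x := {ffun index x -> T}.

Definition std_act (x : 'I_t -> nat) : 'Hom(T, 'End(Std x)) :=
  linfun (fun r => linfun (fun f : Std x => [ffun j => f j * r])).

Lemma std_actE x r (f : Std x) : std_act x r f = [ffun j => f j * r].
Proof.
rewrite bilinfunE // => [a|f'] k u v; apply/ffunP=> j; rewrite !ffunE.
  by rewrite mulrDl scalerAl.
by rewrite mulrDr scalerAr.
Qed.

Lemma std_right_action x : right_action (std_act x).
Proof.
by split=> [f|r r' f]; rewrite !std_actE; apply/ffunP=> j; rewrite !ffunE ?mulr1 ?mulrA.
Qed.

(* The right T-module \bigoplus_i (e_i T)^(x i). *)
Definition std_mod (x : 'I_t -> nat) : {vspace (Std x)} :=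
  (\bigcap_(j : index x) lker (linfun (fun f : Std x => e (tag j) * f j - f j)))%VS.

Lemma std_modP x (f : Std x) :
  f \in std_mod x <-> forall j, e (tag j) * f j = f j.
Proof.
have l (j : index x) : linear (fun f : Std x => e (tag j) * f j - f j).
  move=> k u v; rewrite !ffunE mulrDr -scalerAr scalerBr opprD !addrA.
  by rewrite -!addrA; congr (_ + _); rewrite addrCA.
split=> [fN j|fN].
  apply/eqP; rewrite -subr_eq0; move: fN; rewrite memvE => /subv_bigcapP/(_ j isT).
  by rewrite -memvE memv_ker (linfunE (l j)).
rewrite memvE; apply/subv_bigcapP => j _.
by rewrite -memvE memv_ker (linfunE (l j)) fN subrr.
Qed.

Lemma std_mod_stable x : stable (std_act x) (std_mod x).
Proof.
move=> r f /std_modP fN; apply/std_modP => j.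
by rewrite std_actE ffunE mulrA fN.
Qed.

Lemma basic_idem i : e i * e i = e i.
Proof. by rewrite -(basic_mul sP) mulr1. Qed.

(** The two-sided ideal generated by the e_i contains 1. *)
Lemma basic_ker0 y : (forall i r, y * r * e i = 0) -> y = 0.
Proof.
move=> y0; have [c c1] := basic_full sP.
rewrite -[y]mulr1 -c1 mulr_sumr big1 // => p _.
by rewrite !mulrA y0 mul0r.
Qed.

Lemma sum_index (x : 'I_t -> nat) (E : 'I_t -> nat) :
  (\sum_(j : index x) E (tag j) = \sum_i x i * E i)%N.
Proof.
rewrite -(sig_big_dep (J := fun i => 'I_(x i) : finType)
  xpredT (fun _ => xpredT) (fun i _ => E i)).
by apply: eq_bigr => i _; rewrite sum_nat_const card_ord.
Qed.

Lemma sum_sig (U : nmodType) (x : 'I_t -> nat) (G : forall i, 'I_(x i) -> U) :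
  \sum_(j : index x) G (tag j) (tagged j) = \sum_i \sum_a G i a.
Proof. by rewrite sig_big_dep; apply: eq_big. Qed.

Lemma dim_std_mod x (E : 'I_t -> {vspace T}) :
    (forall i y, y \in E i <-> e i * y = y) ->
  \dim (std_mod x) = (\sum_i x i * \dim (E i))%N.
Proof.
move=> EP; rewrite (dimv_ffun (E := fun j => E (tag j))).
  exact: (sum_index x (fun i => \dim (E i))).
by move=> f; rewrite std_modP; split=> h j; apply/EP.
Qed.

(** For right modules this is Hom_T(e_j T, e_i T), so [dim_corner] plays the part of Schur's
    lemma. *)
Definition corner i j : {vspace T} := (linfun (fun y => e i * y * e j) @: fullv)%VS.

Lemma cornerP i j y : y \in corner i j <-> e i * y * e j = y.
Proof.
have l : linear (fun y => e i * y * e j).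
  by move=> k u v; rewrite mulrDr mulrDl -scalerAr -scalerAl.
split=> [/memv_imgP[z _ ->]|h].
  by rewrite linfunE // !mulrA basic_idem -!mulrA basic_idem.
by rewrite -h -[X in X \in _](linfunE l) memv_img ?memvf.
Qed.

Lemma dim_corner i j : \dim (corner i j) = (if i == j then \dim {:D i} else 0)%N.
Proof.
case: eqP => [<-|/eqP ne].
  apply/esym; apply: (dimv_bij (f := s i)).
    apply: cap0vP => d _; rewrite memv_ker => /eqP d0.
    by apply: (basic_inj sP (i := i)); rewrite d0 linear0.
  apply/vspaceP=> y; apply/idP/idP => [/memv_imgP[d _ ->]|/cornerP <-].
    by apply/cornerP; rewrite -!(basic_mul sP) mul1r mulr1.
  by have [d ->] := basic_corner sP i y; rewrite memv_img ?memvf.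
apply/eqP; rewrite dimv_eq0 -subv0; apply/subvP=> y /cornerP <-.
by rewrite (basic_orth sP) ?mem0v.
Qed.

Section Types.
Variable M : vectType F.

(** [f] restricts to a T-isomorphism from the standard module to M; its values elsewhere on the
    ambient function space are unconstrained. *)
Definition has_type (act : 'Hom(T, 'End(M))) (x : 'I_t -> nat) :=
  exists f : 'Hom(Std x, M),
    [/\ forall r, {in std_mod x, forall w, f (std_act x r w) = act r (f w)},
        (std_mod x :&: lker f = 0)%VS & (f @: std_mod x = fullv)%VS].

Lemma has_type_dim act x (E : 'I_t -> {vspace T}) : has_type act x ->
    (forall i y, y \in E i <-> e i * y = y) ->
  \dim {:M} = (\sum_i x i * \dim (E i))%N.
Proof.
by move=> [f [_ f0 ff]] EP; rewrite -(dim_std_mod x EP) -ff limg_dim_eq.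
Qed.

(** M e_i is the sum of the spaces e_(tag j) T e_i, and only the x i summands of tag i survive. The
    multiplicities are thus read off from dimensions. *)
Lemma has_type_mult act x i : has_type act x ->
  \dim (act (e i) @: fullv) = (x i * \dim {:D i})%N.
Proof.
move=> [f [fact f0 ff]].
have -> : (act (e i) @: fullv = f @: (std_act x (e i) @: std_mod x))%VS.
  rewrite -ff; apply/vspaceP=> m; apply/idP/idP.
    case/memv_imgP=> _ /memv_imgP[w wN ->] ->.
    by rewrite -fact // !memv_img.
  case/memv_imgP=> _ /memv_imgP[w wN ->] ->.
  by rewrite fact // !memv_img.
rewrite limg_dim_eq; last first.
  apply: cap0vP => _ /memv_imgP[w wN ->]; apply: (memv_0cap f0).
  exact: std_mod_stable.
rewrite (dimv_ffun (E := fun j => corner (tag j) i)).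
  rewrite (eq_bigr (fun j : index x => if tag j == i then \dim {:D i} else 0)%N).
    rewrite (sum_index x (fun j => if j == i then \dim {:D i} else 0)%N).
    rewrite (bigD1 i) //= eqxx big1 ?addn0 // => j /negbTE->.
    by rewrite muln0.
  by move=> j _; rewrite dim_corner; case: eqP => [->|].
move=> g; split=> [/memv_imgP[w /std_modP wN ->] j|h].
  by apply/cornerP; rewrite std_actE ffunE !mulrA wN -mulrA basic_idem.
have -> : g = std_act x (e i) g.
  apply/ffunP=> j; rewrite std_actE ffunE.
  by have /cornerP <- := h j; rewrite -!mulrA basic_idem.
apply: memv_img; apply/std_modP => j.
by have /cornerP <- := h j; rewrite !mulrA basic_idem.
Qed.

Lemma has_type_unique act x y : has_type act x -> has_type act y -> x = y.
Proof.
move=> hx hy; apply/funext => i; have := has_type_mult i hx.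
by rewrite (has_type_mult i hy) => /eqP; rewrite eqn_pmul2r ?falg_dim_gt0 // => /eqP.
Qed.

(** M e_i is a right vector space over D_i through [s i]. With x i the size of a basis v_i, the
    summand e_i T of index a maps to M by z |-> v_(i,a) z. *)
Lemma has_type_exists act : right_action act -> exists x, has_type act x.
Proof.
move=> [act1 actM].
pose acts i : 'Hom(D i, 'End(M)) := (act \o s i)%VF.
have actsE i d : acts i d = act (s i d) by rewrite comp_lfunE.
have free i : exists (k : nat) (v : 'I_k -> M) (f : 'Hom({ffun 'I_k -> D i}, M)),
    [/\ forall a, v a \in limg (act (e i)),
        forall d, f d = \sum_a acts i (d a) (v a),
        lker f = 0%VS & limg f = limg (act (e i))].
  have [|d _ /memv_imgP[m _ ->]|_ /memv_imgP[m _ ->]|] :=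
      division_free (divD (i := i)) (act := acts i) _ (U := limg (act (e i))).
  - by move=> x y m; rewrite !actsE (basic_mul sP) actM.
  - by rewrite actsE -actM -(basic_mul sP) mul1r -[d]mulr1 (basic_mul sP) actM memv_img ?memvf.
  - by rewrite actsE -actM basic_idem.
  by move=> k [v [f [h1 h2 h3 h4 _]]]; exists k, v, f.
pose x i := projT1 (cid (free i)).
have freex i : {v : 'I_(x i) -> M & {f : 'Hom({ffun 'I_(x i) -> D i}, M) |
    [/\ forall a, v a \in limg (act (e i)),
        forall d, f d = \sum_a acts i (d a) (v a),
        lker f = 0%VS & limg f = limg (act (e i))]}}.
  by have [v /cid fP] := cid (projT2 (cid (free i))); exists v.
pose v i := projT1 (freex i); pose g i := sval (projT2 (freex i)).
have gP i : [/\ forall a, v i a \in limg (act (e i)),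
        forall d, g i d = \sum_a acts i (d a) (v i a),
        lker (g i) = 0%VS & limg (g i) = limg (act (e i))].
  exact: (svalP (projT2 (freex i))).
pose ix (i : 'I_t) (a : 'I_(x i)) : index x := Tagged (fun i => 'I_(x i)) a.
pose h (f : Std x) := \sum_j act (f j) (v (tag j) (tagged j)).
have hl : linear h.
  move=> k f f'; rewrite /h scaler_sumr -big_split; apply: eq_bigr => j _.
  by rewrite !ffunE actionD.
have hr r f : h (std_act x r f) = act r (h f).
  rewrite /h linear_sum; apply: eq_bigr => j _.
  by rewrite std_actE ffunE actM.
exists x, (linfun h); split=> [r w _||].
- by rewrite !(linfunE hl).
- apply: cap0vP => f /std_modP fN; rewrite memv_ker (linfunE hl) => /eqP f0.
  have ef (i : 'I_t) (b : 'I_(x i)) : e i * f (ix _ b) = f (ix _ b) by exact: fN (ix _ b).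
  suff fia (i : 'I_t) (a : 'I_(x i)) : f (ix _ a) = 0.
    by apply/ffunP=> -[i a]; rewrite ffunE; apply: fia.
  (* Multiplying by r e_i moves the entries into the corner e_i T e_i = D_i, where f = 0 in M
     becomes a linear relation between the v_i; for i' distinct from i the product is 0 by
     orthogonality. *)
  apply: basic_ker0 => i' r.
  have [<-{i'}|ne] := eqVneq i i'; last first.
    by rewrite -ef -(mulrA (e i)) (basic_orth sP).
  have dP (b : 'I_(x i)) : exists d, f (ix _ b) * r * e i = s i d.
    have [d dE] := basic_corner sP i (f (ix _ b) * r).
    by exists d; rewrite -dE mulrA ef.
  pose d : {ffun 'I_(x i) -> D i} := [ffun b => sval (cid (dP b))].
  have dE (b : 'I_(x i)) : f (ix _ b) * r * e i = s i (d b).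
    by rewrite ffunE; case: cid.
  suff d0 : d = 0 by rewrite dE d0 ffunE linear0.
  have [_ gE gk _] := gP i.
  have : d \in lker (g i).
    rewrite memv_ker gE; apply/eqP.
    have := congr1 (act (r * e i)) f0; rewrite linear0 -hr => h0.
    transitivity (h (std_act x (r * e i) f)); last exact: h0.
    transitivity (\sum_(j : index x)
      act (std_act x (r * e i) f (ix _ (tagged j))) (v _ (tagged j))); last first.
      by apply: eq_bigr => -[].
    rewrite (sum_sig (fun i' b => act (std_act x (r * e i) f (ix i' b)) (v i' b))).
    rewrite (bigD1 i) //= [X in _ = _ + X]big1 ?addr0 => [|i' ne].
      by apply: eq_bigr => b _; rewrite std_actE [in RHS]ffunE mulrA dE actsE.
    rewrite big1 // => b _; rewrite std_actE ffunE -fN /= -!mulrA (mulrA _ r) mulrA.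
    by rewrite (basic_orth sP) // linear0 zero_lfunE.
  by rewrite gk memv0 => /eqP.
have mem i a z : e i * z = z -> act z (v i a) \in (linfun h @: std_mod x)%VS.
  move=> ez; pose w : Std x := [ffun j => if j == ix _ a then z else 0].
  have -> : act z (v i a) = linfun h w.
    rewrite (linfunE hl) /h (bigD1 (ix _ a)) //= ffunE eqxx.
    rewrite big1 ?addr0 // => j /negbTE ne.
    by rewrite ffunE ne linear0 zero_lfunE.
  apply: memv_img; apply/std_modP => j; rewrite ffunE.
  by case: eqP => [->|_]; rewrite ?mulr0.
(* Expand m = m 1 by [basic_full]: each term is the image under some T-element of a vector in M e_i,
   spanned by the v_i. *)
apply: fullvP => m; have [c c1] := basic_full sP.
rewrite -[m]act1 -c1 (lin_sum _ _ _ (actionD act m)).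
apply: memv_suml => p _; rewrite !actM; move: (act p.1.1 m) => {}m.
have [_ gE _ gf] := gP p.1.2.
have : act (e p.1.2) m \in limg (g p.1.2) by rewrite gf memv_img ?memvf.
case/memv_imgP=> d _ ->; rewrite gE linear_sum; apply: memv_suml => a _.
by rewrite /= actsE -actM mem // mulrA -(basic_mul sP) mul1r.
Qed.

End Types.

End Classification.

(** * Homomorphisms as modules *)

Lemma bilinear_pack (F : fieldType) (U V W : lmodType F) (f : U -> V -> W) :
    (forall u, linear (f u)) -> (forall v, linear (f^~ v)) ->
  {g : {bilinear U -> V -> W} | forall u v, f u v = g u v}.
Proof.
move=> fr fl; pose g : {bilinear U -> V -> W} :=
  HB.pack f (bilinear_isBilinear.Build F U V W *:%R *:%R f (fl, fr)).
by exists g.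
Qed.

(* [lam] identifies B with End_D(U), for U a right D-module; a homomorphism
   A -> B then makes U a right module over T = D (x) A^o. *)
Section HomsAsModules.
Variables (F : fieldType) (A B D T : falgType F) (tn : {bilinear D -> A -> T}).
Hypothesis tnP : is_tensor_opp tn.
Variables (U : vectType F) (r : 'Hom(D, 'End(U))) (lam : 'Hom(B, 'End(U))).
Hypotheses (rP : right_action r) (lamP : left_action lam).
Hypothesis rlam : forall d b m, r d (lam b m) = lam b (r d m).
Hypothesis lam_inj : injective lam.
Hypothesis lam_full : forall G : 'End(U),
  (forall d m, G (r d m) = r d (G m)) -> exists b, lam b = G.

(** The reversed product of A^o turns the left action of A through [lam] into a right action,
    compatible with [r] because the two commute. *)
Lemma induced_action (phi : 'AHom(A, B)) : {act : 'Hom(T, 'End(U)) |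
  right_action act /\ forall x a m, act (tn x a) m = r x (lam (phi a) m)}.
Proof.
apply: cid; pose f x a : 'End(U) := (r x \o lam (phi a))%VF.
have fr x : linear (f x).
  by move=> k a b; rewrite /f !linearP /= comp_lfunDr comp_lfunZr.
have fl a : linear (f^~ a).
  by move=> k x y; rewrite /f linearP comp_lfunDl comp_lfunZl.
have [g gE] := bilinear_pack fr fl.
have [h hE] := tensor_lift tnP g; exists (linfun h).
have actE x a m : linfun h (tn x a) m = r x (lam (phi a) m).
  by rewrite lfunE /= hE -gE comp_lfunE.
split=> //; split=> [m|x y m].
  by rewrite -(tensor_one tnP) actE rP.1 rmorph1 lamP.1.
apply: (tensor_opp_eq tnP (f := fun x => linfun h (x * y) m)
   (g := fun x => linfun h y (linfun h x m))) => [k u v|k u v|u a].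
- by rewrite mulrDl -scalerAl actionD.
- by rewrite actionD linearP.
apply: (tensor_opp_eq tnP (f := fun y => linfun h (tn u a * y) m)
   (g := fun y => linfun h y (linfun h (tn u a) m))) => [k w v|k w v|v b].
- by rewrite mulrDr -scalerAr actionD.
- by rewrite actionD.
by rewrite (tensor_mul tnP) !actE rmorphM lamP.2 rP.2 rlam.
Qed.

Definition iact phi := sval (induced_action phi).

Lemma iactP phi : right_action (iact phi).
Proof. exact: (svalP (induced_action phi)).1. Qed.

Lemma iactE phi x a m : iact phi (tn x a) m = r x (lam (phi a) m).
Proof. exact: (svalP (induced_action phi)).2. Qed.

Lemma iact_eq phi (V : lmodType F) (f : 'End(U) -> V) (g : T -> V) :
  linear f -> linear g -> (forall x a, f (iact phi (tn x a)) = g (tn x a)) ->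
  forall y, f (iact phi y) = g y.
Proof.
move=> fl gl fg; apply: (tensor_opp_eq tnP (f := fun y => f (iact phi y))) => //.
by move=> k u v; rewrite linearP fl.
Qed.

Variables (t : nat) (E : 'I_t -> falgType F) (s : forall i, 'Hom(E i, T)).
Hypothesis sP : basic_family s.

Lemma conj_same_type (phi psi : 'AHom(A, B)) x :
    conj_orbit phi = conj_orbit psi ->
  has_type s (iact phi) x -> has_type s (iact psi) x.
Proof.
move=> /conj_orbitP[u [v [uv vu uphi]]] [f [fact f0 ff]].
have lK m : lam v (lam u m) = m by rewrite -lamP.2 vu lamP.1.
have lK' m : lam u (lam v m) = m by rewrite -lamP.2 uv lamP.1.
have tw y m : lam u (iact phi y m) = iact psi y (lam u m).
  apply: (iact_eq (phi := phi) (f := fun G => lam u (G m)) (g := fun y => iact psi y (lam u m))).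
  - by move=> k G G'; rewrite add_lfunE scale_lfunE linearP.
  - by move=> k w w'; rewrite actionD.
  by move=> z a; rewrite !iactE -rlam -!lamP.2 uphi.
exists (lam u \o f)%VF; split.
- by move=> y w wN; rewrite !comp_lfunE fact // tw.
- apply: cap0vP => w wN; rewrite memv_ker comp_lfunE => /eqP fw0.
  by apply: (memv_0cap f0 wN); rewrite memv_ker -[f w]lK fw0 linear0.
rewrite limg_comp ff; apply: fullvP => m; rewrite -[m]lK'.
by rewrite memv_img ?memvf.
Qed.

(** An isomorphism of the two T-modules is D-linear, hence [lam u] for some u by [lam_full]; being
    compatible with A, it satisfies u phi(a) = psi(a) u. *)
Lemma same_type_conj (phi psi : 'AHom(A, B)) x :
    has_type s (iact phi) x -> has_type s (iact psi) x ->
  conj_orbit phi = conj_orbit psi.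
Proof.
move=> [f [fact f0 ff]] [g [gact g0 gf]].
have [h [h' [hK h'K hP]]] := transport_iso f0 ff g0 gf.
have hact y m : h (iact phi y m) = iact psi y (h m).
  have : m \in (f @: std_mod s x)%VS by rewrite ff memvf.
  case/memv_imgP=> w wN ->; rewrite -fact // !hP //; first exact: gact.
  exact: std_mod_stable.
have tn1 (ph : 'AHom(A, B)) d m : iact ph (tn d 1) m = r d m.
  by rewrite iactE rmorph1 lamP.1.
have tn2 (ph : 'AHom(A, B)) a m : iact ph (tn 1 a) m = lam (ph a) m.
  by rewrite iactE rP.1.
have hr d m : h (r d m) = r d (h m) by rewrite -(tn1 phi) hact tn1.
have [u uE] := lam_full hr.
have [|v vE] := lam_full (G := h').
  by move=> d m; apply: (can_inj hK); rewrite h'K hr h'K.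
apply/conj_orbitP; exists u, v; split=> [||a]; apply: lam_inj; apply/lfunP=> m.
- by rewrite lamP.2 uE vE h'K lamP.1.
- by rewrite lamP.2 uE vE hK lamP.1.
by rewrite !lamP.2 uE -tn2 hact tn2.
Qed.

Hypothesis divD : division_algebra D.

(** The dimension equation makes [U] and the standard module D-spaces of the same rank. The action
    of A carried back along a D-isomorphism commutes with D, so it comes from elements of B. *)
Lemma type_realized x (N : 'I_t -> {vspace T}) :
    (forall i y, y \in N i <-> s i 1 * y = y) ->
    \dim {:U} = (\sum_i x i * \dim (N i))%N ->
  exists phi : 'AHom(A, B), has_type s (iact phi) x.
Proof.
move=> NP dU; rewrite -(dim_std_mod x NP) in dU.
have D0 := falg_dim_gt0 D.
have [||k [v [f [_ fE fk fU dk]]]] := division_free divD rP.2 (U := fullv).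
- by move=> d u _; rewrite memvf.
- by move=> u _; rewrite rP.1.
pose sr : 'Hom(D, 'End({ffun {i : 'I_t & 'I_(x i)} -> T})) :=
  linfun (fun d => std_act T x (tn d 1)).
have srE d w : sr d w = std_act T x (tn d 1) w.
  rewrite (linfunE (f := fun d => std_act T x (tn d 1))) // => c u u'.
  by rewrite linear_tnl linearP.
have srM d d' w : sr (d * d') w = sr d' (sr d w).
  by rewrite !srE -(std_right_action T x).2 (tensor_mul tnP) mulr1.
have [||k' [v' [g [_ gE gk gU dk']]]] := division_free divD srM (U := std_mod s x).
- by move=> d w wN; rewrite srE std_mod_stable.
- by move=> w wN; rewrite srE (tensor_one tnP) (std_right_action T x).1.
(* Ranks over D agree because dimensions over F do; the substitution lets both bases share one index
   type. *)
have kk' : k = k' by apply/eqP; rewrite -(eqn_pmul2r D0) -dk -dk' dU.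
case: k' / kk' v' g gE gk gU dk' => v' g gE gk gU dk'.
have f0 : (fullv :&: lker f = 0)%VS by rewrite fk capv0.
have g0 : (fullv :&: lker g = 0)%VS by rewrite gk capv0.
have [b bP] := lfun_factor g f0; have [b' b'P] := lfun_factor f g0.
have fonto m : exists w, m = f w.
  by have : m \in limg f; [rewrite fU memvf | case/memv_imgP=> w _ ->; exists w].
have gonto w : w \in std_mod s x -> exists z, w = g z.
  by rewrite -gU => /memv_imgP[z _ ->]; exists z.
have bK m : b' (b m) = m by have [w ->] := fonto m; rewrite bP ?b'P ?memvf.
have b'K w : w \in std_mod s x -> b (b' w) = w.
  by case/gonto=> z ->; rewrite b'P ?bP ?memvf.
have bN m : b m \in std_mod s x.
  by have [w ->] := fonto m; rewrite bP ?memvf // -gU memv_img ?memvf.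
have br d m : b (r d m) = sr d (b m).
  have [w ->] := fonto m; rewrite bP ?memvf //.
  pose w' : {ffun 'I_k -> D} := [ffun i => w i * d].
  have -> : r d (f w) = f w'.
    by rewrite !fE linear_sum; apply: eq_bigr => i _; rewrite ffunE rP.2.
  rewrite bP ?memvf // !gE linear_sum; apply: eq_bigr => i _.
  by rewrite ffunE srM.
have b'r d w : w \in std_mod s x -> b' (sr d w) = r d (b' w).
  by move=> wN; apply: (can_inj bK); rewrite br !b'K // srE std_mod_stable.
pose G a : 'End(U) := (b' \o std_act T x (tn 1 a) \o b)%VF.
have GE a m : G a m = b' (std_act T x (tn 1 a) (b m)) by rewrite !comp_lfunE.
have Gr a d m : G a (r d m) = r d (G a m).
  rewrite !GE br -b'r ?std_mod_stable // !srE -!(std_right_action T x).2.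
  by rewrite (tensor_oppC tnP) (tensor_oppC' tnP).
pose ph a := sval (cid (lam_full (Gr a))).
have phE a m : lam (ph a) m = G a m by rewrite (svalP (cid (lam_full (Gr a)))).
have phl : linear ph.
  move=> c a a'; apply: lam_inj; apply/lfunP=> m.
  rewrite linearP add_lfunE scale_lfunE !phE !GE linear_tnr actionD.
  by rewrite linearP.
have ph1 : ph 1 = 1.
  apply: lam_inj; apply/lfunP=> m; rewrite phE GE (tensor_one tnP).
  by rewrite (std_right_action T x).1 bK lamP.1.
have phM a a' : ph (a * a') = ph a * ph a'.
  apply: lam_inj; apply/lfunP=> m; rewrite lamP.2 !phE !GE b'K ?std_mod_stable //.
  by rewrite -(std_right_action T x).2 (tensor_mul tnP) mulr1.
have phP : ahom_in {:A} (linfun ph).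
  apply/ahom_inP; split=> [a a' _ _|]; rewrite !(linfunE phl) //.
exists (AHom phP); have phiE a : (AHom phP : 'AHom(A, B)) a = ph a by rewrite /= (linfunE phl).
have actE y m : iact (AHom phP) y m = b' (std_act T x y (b m)).
  apply: (iact_eq (phi := AHom phP) (f := fun H => H m) (g := fun y => b' (std_act T x y (b m)))).
  - by move=> c H H'; rewrite add_lfunE scale_lfunE.
  - by move=> c y1 y2; rewrite actionD linearP.
  move=> d a; rewrite iactE phiE phE GE -b'r ?std_mod_stable // srE.
  by rewrite -(std_right_action T x).2 (tensor_oppC' tnP).
exists b'; split.
- by move=> y w wN; rewrite actE b'K.
- apply: cap0vP => w wN; rewrite memv_ker => /eqP w0.
  by rewrite -[w]b'K // w0 linear0.
by apply: fullvP => m; rewrite -[m]bK memv_img.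
Qed.

End HomsAsModules.

Import VectorInternalTheory.

(* For B = End_D(U) and a basis v of U, the idempotent \sum_p p.1 (x) p.2 of B
   yields \sum_(p, i) (p.1)_(0, i) (x) (p.2)_(i, 0) in matrix coordinates. *)
Lemma sep_family_commutant (F : fieldType) (B D : falgType F) (U : vectType F)
    (r : 'Hom(D, 'End(U))) (lam : 'Hom(B, 'End(U))) :
    division_algebra D -> right_action r -> left_action lam ->
    (forall d b m, r d (lam b m) = lam b (r d m)) -> injective lam ->
    (forall G : 'End(U), (forall d m, G (r d m) = r d (G m)) -> exists b, lam b = G) ->
  (exists s : seq (B * B), sep_family s) -> exists s : seq (D * D), sep_family s.
Proof.
move=> divD rP lamP rlam lam_inj lam_full [s [s1 sb]].
have [||k [v [f [_ fE fk fU _]]]] := division_free divD rP.2 (U := fullv).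
- by move=> d u _; rewrite memvf.
- by move=> u _; rewrite rP.1.
have f0 : (fullv :&: lker f = 0)%VS by rewrite fk capv0.
have [c cf] := lfun_factor \1%VF f0.
have {}cf w : c (f w) = w by rewrite cf ?memvf // id_lfunE.
have fc m : f (c m) = m.
  by have : m \in limg f; [rewrite fU memvf | case/memv_imgP=> w _ ->; rewrite cf].
have cr d m : c (r d m) = [ffun i => c m i * d].
  rewrite -[RHS]cf; congr (c _); rewrite -{1}[m]fc !fE linear_sum.
  by apply: eq_bigr => i _; rewrite ffunE rP.2.
(* The coordinate 0 is needed: rank 0 would give U = 0 and, by injectivity of [lam], 1 = 0 in B. *)
case: k v f fE fk fU f0 c cf fc cr => [|k] v f fE fk fU f0 c cf fc cr.
  have U0 (m : U) : m = 0 by rewrite -[m]fc fE big_ord0.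
  have /eqP : 1 = 0 :> B by apply: lam_inj; apply/lfunP=> m; rewrite [LHS]U0 [RHS]U0.
  by rewrite oner_eq0.
have cv i : c (v i) = [ffun j => (j == i)%:R].
  rewrite -[RHS]cf fE (bigD1 i) //= ffunE eqxx rP.1 big1 ?addr0 // => j /negbTE ne.
  by rewrite ffunE ne linear0 zero_lfunE.
exists [seq (c (lam p.1 (v i)) ord0, c (lam p.2 (v ord0)) i) | p <- s, i <- enum 'I_k.+1].
split.
  rewrite big_allpairs_dep /= (eq_bigr (fun p => c (lam (p.1 * p.2) (v ord0)) ord0)).
    have -> : 1 = c (lam 1 (v ord0)) ord0 by rewrite lamP.1 cv ffunE eqxx.
    rewrite -s1 (lin_sum _ _ _ (f := fun b => c (lam b (v ord0)) ord0)) // => a x y.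
    by rewrite actionD linearP !ffunE.
  move=> p _; rewrite big_enum lamP.2 -[in RHS](fc (lam p.2 _)) fE !linear_sum sum_ffunE.
  by apply: eq_bigr => i _; rewrite /= -rlam cr ffunE.
move=> d; rewrite /balanced !big_allpairs_dep /=.
(* This is the matrix with d at (0, 0) and 0 elsewhere. It is [lam a], and balance of [s] against a,
   read at entries (0, i) and (i, 0), is balance of the new family against d. *)
pose a0 m : U := r (d * c m ord0) (v ord0).
have a0l : linear a0.
  by move=> x m m'; rewrite /a0 linearP !ffunE mulrDr -scalerAr actionD.
have [a aE] : exists a, lam a = linfun a0.
  by apply: lam_full => d' m; rewrite !(linfunE a0l) /a0 cr ffunE mulrA rP.2.
have aE' m : lam a m = r (d * c m ord0) (v ord0) by rewrite aE (linfunE a0l).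
have ca m : c (lam a m) ord0 = d * c m ord0.
  by rewrite aE' cr ffunE cv ffunE eqxx mul1r.
pose be i (x y : B) := tens (c (lam x (v i)) ord0) (c (lam y (v ord0)) i).
have bel i y : linear (be i ^~ y).
  by move=> z x x'; rewrite /be actionD linearP !ffunE tens_linearl.
have ber i x : linear (be i x).
  by move=> z y y'; rewrite /be actionD linearP !ffunE tens_linearr.
rewrite exchange_big [RHS]exchange_big; apply: eq_bigr => i _.
transitivity (\sum_(p <- s) be i (a * p.1) p.2).
  by apply: eq_bigr => p _; rewrite /be lamP.2 ca.
rewrite (balanced_lift (sb a) (ber i) (bel i)); apply: eq_bigr => p _.
by rewrite /be lamP.2 aE' cv ffunE eqxx mulr1 -rlam cr ffunE.
Qed.

(** * From End_D(V) to a commutant over F *)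

Section EndAsCommutant.
Variables (F : fieldType) (B D : falgType F) (V : vectType D^c).
Variable rho : B -> 'End(V).
Hypothesis rhoP : is_End rho.

Local Notation U := {ffun 'I_(dim V) -> D}.

(** [V] is given as a vector space over D^c, while the module theory is over F; coordinates replace
    it by the F-space [U], on which D acts by right multiplication. *)
Let h (u : U) : V := r2v (\row_i (u i : D^c)).
Let h' (v : V) : U := [ffun i => v2r v 0 i : D].

Let hK : cancel h h'.
Proof. by move=> u; apply/ffunP=> i; rewrite ffunE /h r2vK mxE. Qed.

Let h'K : cancel h' h.
Proof.
by move=> v; rewrite /h -[RHS]v2rK; congr r2v; apply/rowP=> i; rewrite mxE ffunE.
Qed.

Let hD : {morph h : x y / x + y}.
Proof.
by move=> x y; rewrite /h -linearD; congr r2v; apply/rowP=> i; rewrite !mxE ffunE.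
Qed.

Let hZ (d : D) (u : U) : h [ffun i => u i * d] = (d : D^c) *: h u.
Proof.
by rewrite /h -linearZ; congr r2v; apply/rowP=> i; rewrite !mxE ffunE.
Qed.

Let hk k u : h (k *: u) = (k%:A : D^c) *: h u.
Proof.
rewrite -hZ; congr h; apply/ffunP=> i; rewrite !ffunE.
by rewrite mulr_algr.
Qed.

Lemma End_commutant :
  exists (r : 'Hom(D, 'End(U))) (lam : 'Hom(B, 'End(U))),
    [/\ right_action r, left_action lam,
        forall d b m, r d (lam b m) = lam b (r d m), injective lam
      & forall G : 'End(U), (forall d m, G (r d m) = r d (G m)) ->
          exists b, lam b = G].
Proof.
pose rf d (u : U) : U := [ffun i => u i * d].
have rl1 d : linear (rf d).
  by move=> k x y; apply/ffunP=> i; rewrite !ffunE mulrDl scalerAl.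
have rl2 u : linear (rf^~ u).
  by move=> k x y; apply/ffunP=> i; rewrite !ffunE mulrDr scalerAr.
pose lf b (u : U) : U := h' (rho b (h u)).
have h'D x y : h' (x + y) = h' x + h' y by apply: (can_inj hK); rewrite hD !h'K.
have h'k k x : h' ((k%:A : D^c) *: x) = k *: h' x.
  by apply: (can_inj hK); rewrite hk !h'K.
have ll1 b : linear (lf b).
  by move=> k x y; rewrite /lf hD hk linearP h'D h'k.
have ll2 u : linear (lf^~ u).
  move=> k x y; rewrite /lf (End_add rhoP) add_lfunE (End_scale rhoP).
  by rewrite h'D h'k.
pose r : 'Hom(D, 'End(U)) := linfun (fun d => linfun (rf d)).
pose lam : 'Hom(B, 'End(U)) := linfun (fun b => linfun (lf b)).
have rE d u : r d u = rf d u by rewrite /r bilinfunE.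
have lE b u : lam b u = h' (rho b (h u)) by rewrite /lam bilinfunE.
exists r, lam; split.
- by split=> [u|x y u]; rewrite !rE; apply/ffunP=> i; rewrite !ffunE ?mulr1 ?mulrA.
- split=> [u|x y u]; rewrite !lE ?(End_one rhoP) ?id_lfunE ?hK //.
  by rewrite (End_mul rhoP) comp_lfunE h'K.
- move=> d b u; rewrite !lE !rE; apply: (can_inj hK).
  by rewrite hZ !h'K hZ linearZ.
- move=> b c bc; apply: (bij_inj (End_bij rhoP)); apply/lfunP=> v.
  have : lam b (h' v) = lam c (h' v) by rewrite bc.
  by rewrite !lE h'K => /(can_inj h'K).
move=> G Gr; pose g v := h (G (h' v)).
have gl : linear g.
  move=> k x y; rewrite /g h'D linearD hD; congr (_ + _).
  rewrite -hZ; congr h; have := Gr k (h' x); rewrite !rE => /esym E.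
  transitivity (rf k (G (h' x))) => //; rewrite E; congr (G _).
  by apply: (can_inj hK); rewrite hZ !h'K.
have [rho' _ rhoK] := End_bij rhoP.
exists (rho' (linfun g)); apply/lfunP=> u.
by rewrite lE rhoK (linfunE gl) /g !hK.
Qed.

End EndAsCommutant.

(** The invariant of a homomorphism is the type of the T-module it induces on V. Either hypothesis
    makes T regular, after passing from B to D in the second case. *)
Lemma simple_factor_types (F : fieldType) (A B : falgType F) (d : simple_data A B) :
    (exists s : seq (A * A), sep_family s) \/
    (semisimple_algebra A /\ exists s : seq (B * B), sep_family s) ->
  exists ty : 'AHom(A, B) -> 'I_(sd_t d) -> nat,
    [/\ forall f g, conj_orbit f = conj_orbit g <-> ty f = ty g,
        forall f, P_simple (ty f)
      & forall x, P_simple x -> exists f, ty f = x].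
Proof.
move=> sepAB; case: d => D divD V rho rhoP T tn tnP t E m p pP; rewrite /P_simple /ell /=.
have [r [lam [rP lamP rlam lam_inj lam_full]]] := End_commutant rhoP.
have rad0 : forall x : T, jacobson_radical x -> x = 0.
  apply: regular_radical0; apply: (tensor_opp_regular tnP).
  case: sepAB => [sep|[ssA sep]]; [by left | right; split=> //].
  exact: (sep_family_commutant divD rP lamP rlam lam_inj lam_full sep).
have [s [sP sdim]] := wedderburn_basic pP rad0.
have divE := wedderburn_division pP.
have [N NP] : exists N : 'I_t -> {vspace T}, forall i y, y \in N i <-> s i 1 * y = y.
  have h i : {N : {vspace T} | forall y, y \in N <-> s i 1 * y = y}.
    apply: vspace_of_pred => [|k u v]; first by rewrite mulr0.
    by rewrite mulrDr -scalerAr => -> ->.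
  by exists (fun i => sval (h i)) => i; apply: (svalP (h i)).
have D0 := falg_dim_gt0 D.
(* e_i T is a right D-vector space through [tn x 1], hence free; so the division in [ell] is exact
   and [ell i] is its rank. *)
have dimN i : \dim (N i) = (((m i * \dim {:E i}) %/ \dim {:D}) * \dim {:D})%N.
  rewrite -(sdim i (N i) (NP i)).
  pose rm (w : T) : 'End(T) := linfun (fun y => y * w).
  have rmE w y : rm w y = y * w.
    by rewrite linfunE // => k u v; rewrite mulrDl scalerAl.
  pose act : 'Hom(D, 'End(T)) := linfun (fun x => rm (tn x 1)).
  have actE x y : act x y = y * tn x 1.
    rewrite (linfunE (f := fun x => rm (tn x 1))) ?rmE // => k u v.
    apply/lfunP=> z; rewrite add_lfunE scale_lfunE !rmE linear_tnl.
    by rewrite mulrDr scalerAr.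
  have [|||k [v [f [_ _ _ _ ->]]]] := division_free divD (act := act) _ (U := N i).
  - by move=> x y z; rewrite !actE -mulrA (tensor_mul tnP) mulr1.
  - by move=> x u /NP uN; apply/NP; rewrite actE mulrA uN.
  - by move=> u _; rewrite actE (tensor_one tnP) mulr1.
  by rewrite mulnK.
have dimU : \dim {: {ffun 'I_(dim V) -> D}} = (dim V * \dim {:D})%N.
  by rewrite dim_ffun_full card_ord.
(* The equation defining [P_simple] counts over D; multiplied by dim_F D it becomes the F-dimension
   count of [has_type_dim] and [type_realized]. *)
have memP x : dim V = (\sum_i (m i * \dim {:E i}) %/ \dim {:D} * x i)%N <->
    \dim {: {ffun 'I_(dim V) -> D}} = (\sum_i x i * \dim (N i))%N.
  have -> : (\sum_i x i * \dim (N i) =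
      (\sum_i (m i * \dim {:E i}) %/ \dim {:D} * x i) * \dim {:D})%N.
    rewrite big_distrl; apply: eq_bigr => i _ /=.
    by rewrite dimN mulnA [(x i * _)%N]mulnC.
  rewrite dimU; split=> [<-//|/eqP].
  by rewrite eqn_pmul2r // => /eqP.
pose ia := iact tnP rP lamP rlam.
have tyP f := cid (has_type_exists divE sP (iactP tnP rP lamP rlam f)).
exists (fun f => sval (tyP f)); split=> [f g|f|x /memP xP].
- split=> [fg|e].
    apply: (has_type_unique sP (svalP (tyP f))).
    exact: (conj_same_type (esym fg) (svalP (tyP g))).
  apply: (same_type_conj lam_inj lam_full (svalP (tyP f))).
  by rewrite e; apply: (svalP (tyP g)).
- by apply/memP; apply: (has_type_dim (svalP (tyP f)) NP).
have [f fx] := type_realized tnP rP lamP rlam lam_inj lam_full divD NP xP.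
by exists f; apply: (has_type_unique sP (svalP (tyP f)) fx).
Qed.

Theorem corollary3p7 (F : fieldType) (A B : falgType F)
    (hA : semisimple_algebra A) (hB : semisimple_algebra B)
    (hsep : separable_algebra A \/ separable_algebra B) :
  finite_set (orbit_set A B) /\
  forall d : semisimple_data A B, (orbit_set A B #= P_set d)%card.
Proof.
split=> [|d]; first exact: finite_orbit_set.
pose J := 'I_(ssd_r d); pose z0 (j : J) : ssd_factor j := 0.
have glue (y : forall j : J, ssd_factor j) : {b : B | forall j, ssd_proj j b = y j}.
  by apply: cid; have [b [bP _]] := ssd_proj_bij y; exists b.
have inj (b c : B) : (forall j : J, ssd_proj j b = ssd_proj j c) -> b = c.
  move=> bc; have [b' [_ b'u]] := ssd_proj_bij (fun j : J => ssd_proj j b).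
  by rewrite -(b'u b) // -(b'u c) // => j; rewrite bc.
have types (j : J) : exists ty : 'AHom(A, ssd_factor j) -> 'I_(sd_t (ssd_data j)) -> nat,
    [/\ forall f g, conj_orbit f = conj_orbit g <-> ty f = ty g,
        forall f, P_simple (ty f)
      & forall x, P_simple x -> exists f, ty f = x].
  apply: simple_factor_types; case: hsep => [/separable_family|/separable_family] sep.
    by left.
  right; split=> //; apply: (sep_family_quotient (f := ssd_proj j)) sep => b.
  (* The projection is onto: b lifts through the tuple with b at place j and 0 elsewhere. *)
  by have [c cP] := glue (dfwith z0 b); exists c; rewrite cP dfwith_in.
pose ty (j : J) := sval (cid (types j)).
have tyP (j : J) := svalP (cid (types j)).
(* Homomorphisms into B, and conjugating units of B, are families of the same over the factors; so
   orbits and types can be compared one factor at a time. *)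
pose pr (f : 'AHom(A, B)) (j : J) : 'AHom(A, ssd_factor j) := (ssd_proj j \o f)%AF.
have prE f j a : pr f j a = ssd_proj j (f a) by rewrite /= comp_lfunE.
apply: (orbit_set_fibers (ty := fun f j => ty j (pr f j))) => [f g|f j|x xP].
- split=> [/conj_orbitP[u [v [uv vu ufg]]]|e].
    apply/functional_extensionality_dep => j; have [tyE _ _] := tyP j.
    apply/tyE/conj_orbitP; exists (ssd_proj j u), (ssd_proj j v).
    by split=> [||a]; rewrite ?prE -!rmorphM ?uv ?vu ?rmorph1 ?ufg.
  have fg (j : J) : ty j (pr f j) = ty j (pr g j) := congr1 (@^~ j) e.
  have uP (j : J) : {uv : ssd_factor j * ssd_factor j | [/\ uv.1 * uv.2 = 1,
      uv.2 * uv.1 = 1 & forall a, uv.1 * pr f j a = pr g j a * uv.1]}.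
    apply: cid; have [tyE _ _] := tyP j.
    by have /tyE/conj_orbitP[u [v uvP]] := fg j; exists (u, v).
  have [u uE] := glue (fun j => (sval (uP j)).1).
  have [v vE] := glue (fun j => (sval (uP j)).2).
  apply/conj_orbitP; exists u, v; split=> [||a]; apply: inj => j;
    rewrite !rmorphM ?rmorph1 /= ?uE ?vE -?prE; by have [] := svalP (uP j).
- by have [_ tyT _] := tyP j; apply: tyT.
have hP (j : J) : {f : 'AHom(A, ssd_factor j) | ty j f = x j}.
  by apply: cid; have [_ _ /(_ _ (xP j))] := tyP j.
pose h a := sval (glue (fun j => sval (hP j) a)).
have hE a (j : J) : ssd_proj j (h a) = sval (hP j) a.
  exact: (svalP (glue (fun j => sval (hP j) a))).
have hl : linear h.
  by move=> k a b; apply: inj => j; rewrite linearP /= !hE linearP.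
have hA' : ahom_in {:A} (linfun h).
  apply/ahom_inP; split=> [a b _ _|]; rewrite !(linfunE hl); apply: inj => j.
    by rewrite rmorphM /= !hE rmorphM.
  by rewrite rmorph1 hE rmorph1.
exists (AHom hA'); apply/functional_extensionality_dep => j; rewrite -(svalP (hP j)).
congr (ty j _); apply/val_inj/lfunP=> a.
by rewrite /= comp_lfunE (linfunE hl) hE.
Qed.
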